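(* Let $n\ge 2$ and let $\Omega$ be a domain in $\mathbb{R}^n$ whose boundary $\partial\Omega$ is porous (in particular, it suffices that $\partial\Omega$ is a $d$-set with $d<n$). Let $1<p<\infty$, $1\le q<\infty$, $s>0$, and let $f\in F^s_{pq}(\mathbb{R}^n)$. Then \[ \|f\chi_\Omega\|_{F^s_{pq}(\mathbb{R}^n)}\le c\,\bigg\{\|f\|_{F^s_{pq}(\mathbb{R}^n)}+\bigg(\int_\Omega\frac{|f(y)|^p}{\mathrm{dist}(y,\partial\Omega)^{sp}}\,dy\bigg)^{1/p}\bigg\}, \] where the constant $c$ depends on $p$, $q$, $s$, $n$, $d$, and $\partial\Omega$ (and not on $f$).
   Context: Distances in $\mathbb{R}^n$ are measured in the supremum norm. $Q(x,r)$ denotes the closed cube centered at $x\in\mathbb{R}^n$ with side length $2r$ and sides parallel to the coordinate axes. $\chi_E$ is the characteristic function of $E$. $\mathcal{H}^d$ is the $d$-dimensional Hausdorff measure. Porous set: a set $S\subset\mathbb{R}^n$ is porous if for some $\kappa\ge1$ the following holds: for every cube $Q(x,r)$ with $x\in\mathbb{R}^n$ and $0<r\le1$ there is $y\in Q(x,r)$ such that $Q(y,r/\kappa)\cap S=\emptyset$. $d$-set: for $0<d\le n$, a closed set $S\subset\mathbb{R}^n$ is a $d$-set if there is a constant $C>1$ such that $C^{-1}r^d\le\mathcal{H}^d(Q(w,r)\cap S)\le Cr^d$ for every $w\in S$ and $0<r\le1$. Local approximation: $\mathcal{P}_{m}$ is the space of polynomials on $\mathbb{R}^n$ of degree at most $m$.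 For $f\in L^u_{\mathrm{loc}}(\mathbb{R}^n)$, $1\le u\le\infty$, an integer $k\ge 1$ and a cube $Q$, \[\mathcal{E}_k(f,Q)_{L^u(\mathbb{R}^n)}:=\inf_{P\in\mathcal{P}_{k-1}}\Big(\frac1{|Q|}\int_Q|f(x)-P(x)|^u\,dx\Big)^{1/u}.\] Triebel--Lizorkin space: let $s>0$, $1\le p<\infty$, $1\le q\le\infty$, let $k$ be an integer with $s<k$ and $1\le u\le\min\{p,q\}$. For $f\in L^u_{\mathrm{loc}}(\mathbb{R}^n)$ put $g(x):=\big(\int_0^1\big(t^{-s}\mathcal{E}_k(f,Q(x,t))_{L^u(\mathbb{R}^n)}\big)^q\frac{dt}{t}\big)^{1/q}$ if $q<\infty$, and $g(x):=\sup_{0<t\le1}t^{-s}\mathcal{E}_k(f,Q(x,t))_{L^u(\mathbb{R}^n)}$ if $q=\infty$. Then $f\in F^s_{pq}(\mathbb{R}^n)$ if $f,g\in L^p(\mathbb{R}^n)$, and $\|f\|_{F^s_{pq}(\mathbb{R}^n)}:=\|f\|_{L^p(\mathbb{R}^n)}+\|g\|_{L^p(\mathbb{R}^n)}$. Different admissible choices of $k$ and $u$ give equivalent norms; any fixed choice may be used. *)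

(* Defs.v *)
From HB Require Import structures.
From mathcomp Require Import all_boot all_order all_algebra.
From mathcomp Require Import all_classical all_reals all_analysis.
From mathcomp Require Import measurable_realfun urysohn.
(* The notations of mpoly clash with those of all_analysis. *)
From mathcomp Require Import -(notations) mpoly.

Set Implicit Arguments.
Unset Strict Implicit.
Unset Printing Implicit Defensive.

Import Order.TTheory GRing.Theory Num.Theory.
Import numFieldNormedType.Exports.

Local Open Scope classical_set_scope.
Local Open Scope ring_scope.

(* Infimum of the total cost [c] over the countable covers of [A] by sets [E i]
   with [i] in [D]; [None] stands for the empty set at no cost, so that finite
   covers are allowed. *)
Definition cover_outer (R : realType) (T I : Type) (D : set I) (E : I -> set T)
    (c : I -> \bar R) (A : set T) : \bar R :=
  ereal_inf [set (\sum_(k <oo) oapp c 0 (F k))%E | F in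
    [set F : nat -> option I | (forall k, oapp D True (F k)) /\
       A `<=` \bigcup_k oapp E set0 (F k)]].

Section cover_outer_lemmas.
Local Open Scope ereal_scope.
Context (R : realType) (T I : Type) (D : set I) (E : I -> set T).
Context (c : I -> \bar R) (c0 : forall i, 0 <= c i).
Local Notation mu := (cover_outer D E c).

Let oc0 (o : option I) : 0 <= oapp c 0 o. Proof. by case: o. Qed.

Lemma cover_outer_ge0 A : 0 <= mu A.
Proof. by apply: le_ereal_inf_tmp => x [F _ <-]; exact: nneseries_ge0. Qed.

Lemma le_cover_outer : {homo mu : A B / A `<=` B >-> A <= B}.
Proof.
move=> A B AB; apply/ereal_inf_le_tmp => x [F [DF BF] <-]; exists F => //.
by split => //; exact: subset_trans BF.
Qed.

Lemma cover_outer0 : mu set0 = 0.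
Proof.
apply/eqP; rewrite eq_le cover_outer_ge0 andbT.
by apply: ereal_inf_lbound; exists (fun=> None); [split|exact: eseries0].
Qed.

Lemma cover_outer_sigma_subadditive : sigma_subadditive mu.
Proof.
move=> A; have [[i ioo]|] := pselect (exists i, mu (A i) = +oo).
  rewrite (eseries_pinfty _ _ ioo) ?leey// => n _.
  by rewrite -ltNye (lt_le_trans _ (cover_outer_ge0 _)).
rewrite -forallNE => Aoo; apply/lee_addgt0Pr => _/posnumP[e].
rewrite (le_trans _ (epsilon_trick _ _ _))//; last first.
  by move=> n; exact: cover_outer_ge0.
have [G PG] : {G : nat -> nat -> option I & forall n,
    [/\ forall k, oapp D True (G n k), A n `<=` \bigcup_k oapp E set0 (G n k) &
     \sum_(k <oo) oapp c 0 (G n k) <= mu (A n) + (e%:num / (2 ^ n.+1)%:R)%:E]}.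
  apply: (@choice _ _ (fun n F => [/\ forall k, oapp D True (F k),
    A n `<=` \bigcup_k oapp E set0 (F k) &
    \sum_(k <oo) oapp c 0 (F k) <= mu (A n) + (e%:num / (2 ^ n.+1)%:R)%:E])).
  move=> n.
  have muAn : mu (A n) \is a fin_num.
    rewrite ge0_fin_numE ?cover_outer_ge0// ltey; exact/eqP/Aoo.
  have en1 : (0 < e%:num / (2 ^ n.+1)%:R :> R)%R by [].
  have [_ [F [DF AF] <-] /ltW Fle] := lb_ereal_inf_adherent en1 muAn.
  by exists F; split.
pose g (x : nat * nat) : \bar R := oapp c 0 (G x.1 x.2).
have g0 x : 0 <= g x by exact: oc0.
apply: (@le_trans _ _ (\esum_(i in setT) g i)).
  apply: ereal_inf_lbound => /=.
  have /card_esym/ppcard_eqP[f] := card_nat2.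
  exists (uncurry G \o f).
    split => [k|t [i _ Ait]] /=.
      by rewrite /uncurry; case: (f k) => a b; have [+ _ _] := PG a; exact.
    have [_ /(_ _ Ait) [j _ Gijt] _] := PG i.
    by exists (f^-1%FUN (i, j)) => //=; rewrite invK ?inE.
  rewrite (@eq_eseriesr _ _ (g \o f)); last first.
    by move=> k _ /=; rewrite /g /uncurry; case: (f k).
  rewrite -(esum_pred_image g _ xpredT) ?[fun=> _]set_true//.
  by rewrite image_eq.
rewrite (_ : esum _ _ = \sum_(i <oo) \sum_(j <oo) oapp c 0 (G i j)); last first.
  pose J : nat -> set (nat * nat) := fun i => [set (i, j) | j in setT].
  rewrite (_ : setT = \bigcup_k J k); last first.
    by rewrite predeqE => -[a b]; split => // _; exists a => //; exists b.
  rewrite esum_bigcupT /=; last 2 first.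
    - apply/trivIsetP => i j _ _ ij.
      rewrite predeqE => -[n m] /=; split => //= -[] [_] _ [<-{n} _].
      by move=> [m' _] [] /esym/eqP; rewrite (negbTE ij).
    - by [].
  rewrite -(image_id [set: nat]) -fun_true esum_pred_image//; last first.
    by move=> n _; exact: esum_ge0.
  apply: eq_eseriesr => /= j _.
  rewrite -(esum_pred_image g (pair j) predT)//=; last first.
    by move=> ? ? _ _; exact: (@can_inj _ _ _ snd).
  by congr esum; rewrite predeqE => -[a b]; split; move=> [i _ <-]; exists i.
by apply: lee_nneseries => i _; [move=> _; exact: nneseries_ge0|have [] := PG i].
Qed.

End cover_outer_lemmas.

(* The norm and the topology of ['rV[R]_n] are those of the supremum norm. *)

Definition cube (R : realType) (n : nat) (x : 'rV[R]_n) (r : R) : set 'rV[R]_n :=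
  [set y | `|x - y| <= r].

Section lebesgue_rV.
Context (R : realType) (n : nat).

(* The box with opposite corners [ab.1] and [ab.2], empty if
   [ab.2 0 i < ab.1 0 i] for some [i]. *)
Definition box (ab : 'rV[R]_n * 'rV[R]_n) : set 'rV[R]_n :=
  [set x | forall i, ab.1 0 i <= x 0 i <= ab.2 0 i].

Definition box_volume (ab : 'rV[R]_n * 'rV[R]_n) : \bar R :=
  (\prod_i Num.max 0 (ab.2 0 i - ab.1 0 i))%:E.

Lemma box_volume_ge0 ab : (0 <= box_volume ab)%E.
Proof. by rewrite lee_fin prodr_ge0// => i _; rewrite le_max lexx. Qed.

Definition lebesgue_outer_rV : set 'rV[R]_n -> \bar R :=
  cover_outer setT box box_volume.

HB.instance Definition _ := isOuterMeasure.Build R 'rV[R]_n lebesgue_outer_rV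
  (cover_outer0 _ _ box_volume_ge0) (cover_outer_ge0 _ _ box_volume_ge0)
  (le_cover_outer _ _ _) (cover_outer_sigma_subadditive _ _ box_volume_ge0).

(* ['rV[R]_n] with the sigma-algebra of the Lebesgue measurable sets *)
Definition lebesgue_rV := caratheodory_type lebesgue_outer_rV.
HB.instance Definition _ := Measurable.on lebesgue_rV.

Let outer : {outer_measure set 'rV[R]_n -> \bar R} := lebesgue_outer_rV.

Definition lebesgue_measure_rV : {measure set lebesgue_rV -> \bar R} :=
  (outer : set (caratheodory_type outer) -> \bar R).

End lebesgue_rV.

Arguments lebesgue_outer_rV {R n}.
Arguments lebesgue_measure_rV {R n}.

Section hausdorff.
Context (R : realType) (n : nat).
Local Open Scope ereal_scope.

(* [-oo] for the empty set, whose cost [diam set0 `^ d] is nevertheless [0] *)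
Definition diam (A : set 'rV[R]_n) : \bar R :=
  ereal_sup [set `|xy.1 - xy.2|%:E | xy in A `*` A].

(* Not normalized: no volume constant of the unit ball. *)
Definition hausdorff_measure (d : R) (A : set 'rV[R]_n) : \bar R :=
  ereal_sup [set cover_outer [set E | diam E <= delta%:E] id
                   (fun E => diam E `^ d) A | delta in [set delta | (0 < delta)%R]].

End hausdorff.

Section geometry.
Context (R : realType) (n : nat).
Implicit Types A S : set 'rV[R]_n.

Definition domain A := [/\ open A, connected A & A !=set0].

Definition boundary A : set 'rV[R]_n := closure A `\` A^°.

Definition porous S := exists2 kappa : R, 1 <= kappa &
  forall (x : 'rV[R]_n) (r : R), 0 < r <= 1 ->
    exists2 y, cube x r y & cube y (r / kappa) `&` S = set0.

Definition d_set (d : R) S := [/\ 0 < d <= n%:R, closed S &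
  exists2 C : R, 1 < C & forall (w : 'rV[R]_n) (r : R), S w -> 0 < r <= 1 ->
    ((C^-1 * r `^ d)%:E <= hausdorff_measure d (cube w r `&` S)
       <= (C * r `^ d)%:E)%E].

End geometry.

Section triebel_lizorkin.
Context (R : realType) (n : nat).
Implicit Type f : 'rV[R]_n -> R.
Local Notation lambda := (@lebesgue_measure_rV R n).

(* [mmeasure (@mdeg n) P] is one plus the total degree of [P], or 0 if [P = 0]. *)
Definition poly_lt_deg (k : nat) : set (mpoly n R) :=
  [set P | (mmeasure (@mdeg n) P <= k)%N].

Definition mpoly_eval (P : mpoly n R) (y : 'rV[R]_n) : R :=
  meval (fun i => y 0 i) P.

Local Open Scope ereal_scope.

Definition local_approx (k : nat) (u : R) f (Q : set 'rV[R]_n) : \bar R :=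
  ereal_inf [set ((lambda Q)^-1 *
      \int[lambda]_(y in Q) ((`|f y - mpoly_eval P y| `^ u)%:E)) `^ u^-1
    | P in poly_lt_deg k].

(* The function [g] of the definition of F^s_pq, for finite [q]. *)
Definition TL_fun (k : nat) (u s q : R) f (x : 'rV[R]_n) : \bar R :=
  (\int[lebesgue_measure]_(t in `]0%R, 1%R[)
     (((t `^ (- s))%:E * local_approx k u f (cube x t)) `^ q * (t^-1)%:E))
  `^ q^-1.

Definition in_Lp (p : R) (h : 'rV[R]_n -> \bar R) : Prop :=
  measurable_fun [set: lebesgue_rV R n] (h : lebesgue_rV R n -> \bar R) /\
  'N[lambda]_p%:E[h] < +oo.

(* [f] is in L^u_loc as soon as it is in L^p, since [u <= p] in the admissible
   range. *)
Definition in_TL (k : nat) (u s p q : R) f : Prop :=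
  in_Lp p (EFin \o f) /\ in_Lp p (TL_fun k u s q f).

(* The norm is infinite outside F^s_pq, so that an upper bound by a finite
   quantity includes membership. *)
Definition TL_norm (k : nat) (u s p q : R) f : \bar R :=
  if `[< in_TL k u s p q f >]
  then 'N[lambda]_p%:E[EFin \o f] + 'N[lambda]_p%:E[TL_fun k u s q f]
  else +oo.

(* [edist_inf] is infinite, hence the integrand zero, if the boundary is empty. *)
Definition hardy_term (s p : R) f (Omega : set 'rV[R]_n) : \bar R :=
  (\int[lambda]_(y in Omega)
     ((`|f y| `^ p)%:E / edist_inf (boundary Omega) y `^ (s * p))) `^ p^-1.

End triebel_lizorkin.

(* Main.v *)
Require Import Defs.
From HB Require Import structures.
From mathcomp Require Import all_boot all_order all_algebra.
From mathcomp Require Import all_classical all_reals all_analysis.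
From mathcomp Require Import measurable_realfun urysohn.
From mathcomp Require Import ring lra.
From mathcomp Require Import -(notations) mpoly.
Import Order.TTheory GRing.Theory Num.Theory.
Import numFieldNormedType.Exports.

(** Write F for the product of f and the indicator of Omega, S for the boundary
of Omega and delta for the distance to S.

A cube that misses S lies in Omega or in its complement, so that there the local
approximation error of F is at most that of f.  On a cube Q(x,t) that meets S the
error is bounded by means of the zero polynomial.  All points y of such a cube
satisfy delta(y) + |x - y| <= 3t, so the mean of |F|^u over the cube, multiplied
by t^(-su), is at most
<<
   b(t) = t^(-n-su) int_{delta(y) + |x-y| <= 3t} delta(y)^(su) H(y) dy,
>>
where H = |f|^u / delta^(su) on Omega and H = 0 elsewhere.  Both sup b and the
integral of b(t) dt/t are at most a constant times
<<
   T H(x) = int delta(y)^(su) / (delta(y) + |x-y|)^(n+su) H(y) dy,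
>>
and q/u >= 1, so the integral of b(t)^(q/u) dt/t is at most a constant times
(T H(x))^(q/u) [integral_cone_mean_powR].  Hence the function g of F is at most a
constant times g of f plus (T H)^(1/u) [TL_fun_cutoff_le].  The L^p norm of
H^(1/u) is the Hardy term, and it remains to bound T on L^P with P = p/u >= 1
[potential_Lp_bounded].

For P = 1 this is Tonelli's theorem, the kernel having a bounded integral in x.
For larger P the point is the inequality (T H)^P <= C T(H (T H)^(P-1))
[potential_self_improving].  Order the points y by rho(x,y) = delta(y) + |x-y|.
If rho(x,y) <= 2 rho(x,z), then rho(y,z) <= 3 rho(x,z), so that the kernel at
(x,z) is at most a constant times the kernel at (y,z).  Therefore T H(y) is at
least a constant times the mass which the measure K(x,.)H gives to the z beyond
y; for at least half of the y, in the sense of the same measure, this mass is at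
least half of the total mass T H(x).  Integrating the inequality in x and using
the case P = 1 gives int (T H)^P <= C int H (T H)^(P-1), and the right-hand side
is absorbed by Young's inequality once int (T H)^P is known to be finite, which
is the case after truncation of H.

Membership of F in the space also requires g to be measurable: the local
approximation error is upper semicontinuous in (x,t), being an infimum of upper
semicontinuous functions, and Tonelli's theorem applies. *)

Set Implicit Arguments.
Unset Strict Implicit.
Unset Printing Implicit Defensive.

Local Open Scope classical_set_scope.
Local Open Scope ring_scope.

(** * Powers, series and power tails *)

Lemma powR_le (R : realType) (a b r : R) : 0 <= r -> 0 <= a -> a <= b -> a `^ r <= b `^ r.
Proof. by move=> r0 a0 ab; apply: ge0_ler_powR => //; rewrite nnegrE// (le_trans a0). Qed.

Lemma powR_leN (R : realType) (a b r : R) : 0 <= r -> 0 < a -> a <= b -> b `^ (- r) <= a `^ (- r).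
Proof.
move=> r0 a0 ab; rewrite !powRN lef_pV2 ?posrE ?powR_gt0 ?(lt_le_trans a0)//.
by rewrite powR_le// ltW.
Qed.

Lemma poweR_le (R : realType) (a b : \bar R) (r : R) :
  0 <= r -> (0 <= a -> a <= b -> a `^ r <= b `^ r)%E.
Proof.
move=> r0 a0 ab; apply: gt0_ler_poweR => //.
  by rewrite in_itv/= a0 leey.
by rewrite in_itv/= (le_trans a0 ab) leey.
Qed.

Lemma powR_add_le (R : realType) (a b r : R) : 0 <= a -> 0 <= b -> 0 <= r ->
  (a + b) `^ r <= 2 `^ r * (a `^ r + b `^ r).
Proof.
move=> a0 b0 r0; rewrite mulrDr -!powRM//.
have [ab|ba] := leP a b.
  by rewrite ler_wpDl ?powR_ge0// powR_le ?addr_ge0//; lra.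
by rewrite ler_wpDr ?powR_ge0// powR_le ?addr_ge0//; lra.
Qed.

Lemma powRV_lt (R : realType) (w c u : R) : 0 < u -> 0 <= w -> 0 < c ->
  (w `^ u^-1 < c) = (w < c `^ u).
Proof.
move=> u0 w0 c0; have un0 : u != 0 by rewrite gt_eqF.
rewrite !ltNge; congr (~~ _); apply/idP/idP => h.
  have := powR_le (ltW u0) (ltW c0) h.
  by rewrite -powRrM mulVf// powRr1.
have := @powR_le _ _ _ u^-1 _ (powR_ge0 _ _) h.
by rewrite -powRrM mulfV// powRr1 ?(ltW c0)//; apply; rewrite invr_ge0 ltW.
Qed.

(** Valid for all exponents [r >= 0], hence usable both for [p] and for [p^-1]. *)
Lemma poweR_add_le (R : realType) (a b : \bar R) (r : R) : (0 <= a -> 0 <= b -> (0 <= r)%R ->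
  (a + b) `^ r <= (2 `^ r)%:E * (a `^ r + b `^ r))%E.
Proof.
move=> a0 b0 r0; rewrite -poweR_EFin.
have two0 : (0 <= 2%:E :> \bar R)%E by rewrite lee_fin.
rewrite muleDr ?ge0_adde_def ?inE ?poweR_ge0// -!poweRM//.
have tw (x : \bar R) : (2%:E * x = x + x)%E by rewrite (mule_natl x 2) mule2n.
have [ab|ba] := leP a b.
  apply: (@le_trans _ _ ((2%:E * b) `^ r)%E); last by rewrite leeDr ?poweR_ge0.
  by rewrite poweR_le ?adde_ge0// tw leeD2r.
apply: (@le_trans _ _ ((2%:E * a) `^ r)%E); last by rewrite leeDl ?poweR_ge0.
by rewrite poweR_le ?adde_ge0// tw leeD2l// ltW.
Qed.

(** Either [D * a <= v / 2] and the first term on the right dominates, or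
[v < 2 * D * a] and the second does.  The factor [2^-1] allows the absorption of
the first term; [P = 1] is included. *)
Lemma young_absorb (R : realType) (D a v P : R) : 0 <= D -> 0 <= a -> 0 <= v -> 1 <= P ->
  D * (a * v `^ (P - 1)) <= 2^-1 * v `^ P + (2 * D) `^ (P - 1) * D * a `^ P.
Proof.
move=> D0 a0 v0 P1; have P0 : (0 < P) by rewrite (lt_le_trans ltr01).
rewrite -(mulr_powRB1 v0 P0) -(mulr_powRB1 a0 P0) mulrA.
have [Dav|vDa] := leP (D * a) (2^-1 * v).
  rewrite ler_wpDr ?mulr_ge0 ?powR_ge0// mulrA ler_wpM2r ?powR_ge0//.
rewrite ler_wpDl ?mulr_ge0 ?powR_ge0 ?invr_ge0//.
rewrite (_ : (_ * D * _) = (D * a) * ((2 * D) `^ (P - 1) * a `^ (P - 1))); last by ring.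
by rewrite -powRM ?mulr_ge0// ler_wpM2l ?mulr_ge0// powR_le ?subr_ge0//; lra.
Qed.

Lemma nneseries_geometric (R : realType) (a z : R) : 0 <= a -> 0 <= z < 1 ->
  (\sum_(j <oo) (a * z ^+ j)%:E = (a / (1 - z))%:E)%E.
Proof.
move=> a0 /andP[z0 z1]; apply/cvg_lim => //.
under eq_fun do rewrite sumEFin.
apply/cvg_EFin; first exact: nearW.
by apply: cvg_geometric_series; rewrite ger0_norm.
Qed.

Lemma nneseries_ge_term (R : realType) (f : (\bar R)^nat) j : (forall i, 0 <= f i)%E ->
  (f j <= \sum_(i <oo) f i)%E.
Proof.
move=> f0; have := @nneseries_lim_ge R f xpredT 0%N j.+1 (fun i _ _ => f0 i).
apply: le_trans; rewrite big_nat_recr//=.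
by rewrite leeDr// sume_ge0.
Qed.

Section power_tail.
Context d (T : measurableType d) (R : realType) (mu : {measure set T -> \bar R}).
Variables (D : set T) (mD : measurable D) (g : T -> R) (A b : R).
Hypotheses (mg : measurable_fun D g) (g0 : forall x, D x -> 0 <= g x).
Hypothesis muA : forall r, 0 < r -> (mu (D `&` [set x | (g x <= r)%R]) <= (A * r `^ b)%:E)%E.

(** The integral of [(c + g)^(-beta)] converges with the natural power of [c] as soon
as the sublevel sets of [g] grow like a power [b < beta].  It serves twice: for the
distance to a point, with [b] the dimension, and for the scale [t] on the unit
interval, with [b = 1]. *)
Lemma integral_power_tail (c beta : R) : 0 <= b -> b < beta -> 0 < c ->
  (\int[mu]_(x in D) (((c + g x) `^ (- beta))%:E) <=
   (A * 2 `^ b / (1 - 2 `^ (b - beta)) * c `^ (b - beta))%:E)%E.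
Proof.
move=> b0 bb c0.
have A0 : 0 <= A.
  have := le_trans (measure_ge0 mu _) (muA (@ltr01 R)).
  by rewrite lee_fin powR1 mulr1.
have two j : 0 < (2 ^+ j * c : R) by rewrite mulr_gt0// exprn_gt0.
(* On the first of these nested sublevel sets that contains [x], the integrand is at
   most [(2^j c)^(-beta)]. *)
pose I j := [set x | D x /\ g x <= 2 ^+ j.+1 * c].
have mI j : measurable (I j).
  have -> : I j = D `&` g @^-1` `]-oo, 2 ^+ j.+1 * c].
    by apply/seteqP; split=> x /=; rewrite in_itv/=.
  exact: mg.
pose h j x : \bar R := ((2 ^+ j * c) `^ (- beta) * \1_(I j) x)%:E.
have h0 j x : (0 <= h j x)%E by rewrite lee_fin mulr_ge0 ?powR_ge0.
have mh j : measurable_fun D (h j).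
  apply/measurable_EFinP; apply: measurable_funM; first exact: measurable_cst.
  exact: measurable_indic.
apply: (@le_trans _ _ (\int[mu]_(x in D) \sum_(j <oo) h j x)%E).
  apply: ge0_le_integral => //.
  - by move=> x _; rewrite lee_fin powR_ge0.
  - apply/measurable_EFinP.
    apply: (@measurableT_comp _ _ _ _ _ _ ((@powR R)^~ (- beta))) => //.
    exact: measurable_funD.
  - exact: ge0_emeasurable_sum.
  - move=> x Dx.
    have ex : exists j, g x <= 2 ^+ j.+1 * c.
      exists (Num.truncn (g x / c)).
      rewrite -ler_pdivrMr// (le_trans (ltW (truncnS_gt _)))//.
      by rewrite -natrX ler_nat ltnW// ltn_expl.
    case: (ex_minnP ex) => j gj minj.
    apply: (@le_trans _ _ (h j x)); last exact: nneseries_ge_term.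
    rewrite /h lee_fin indicE mem_set//= mulr1 powR_leN//.
      by rewrite (le_trans b0)// ltW.
    case: j gj minj => [_ _|j gj minj].
      by rewrite expr0 mul1r lerDl g0.
    have : ~~ (g x <= 2 ^+ j.+1 * c).
      by apply/negP => /minj; rewrite ltnn.
    rewrite -ltNge => /ltW gx; rewrite (le_trans gx)// lerDr ltW//.
rewrite integral_nneseries//.
have z1 : 0 <= (2 : R) `^ (b - beta) < 1.
  rewrite powR_ge0/= -(opprB beta b) powRN invf_lt1 ?powR_gt0//.
  by rewrite -[X in X < _](congr1 (@^~ (beta - b)) (powR1 R)) gt0_ltr_powR ?subr_gt0 ?nnegrE// ltr1n.
rewrite (_ : (A * 2 `^ b / _ * _)%R =
  (A * 2 `^ b * c `^ (b - beta)) / (1 - 2 `^ (b - beta)))%R; last by rewrite mulrAC.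
rewrite -nneseries_geometric//; last by rewrite !mulr_ge0// powR_ge0.
apply: lee_nneseries => [j _ _|j _]; first exact: integral_ge0.
rewrite /h; under eq_integral do rewrite EFinM.
rewrite ge0_integralZl_EFin ?powR_ge0//; last first.
  by apply/measurable_EFinP; exact: measurable_indic.
rewrite integral_indic// setIC.
rewrite (_ : D `&` I j = D `&` [set x | g x <= 2 ^+ j.+1 * c]); last first.
  by apply/seteqP; split=> x /= => [[? []]|[]].
apply: (@le_trans _ _ (((2 ^+ j * c) `^ (- beta))%:E *
   (A * (2 ^+ j.+1 * c) `^ b)%:E))%E.
  by rewrite lee_wpmul2l ?lee_fin ?powR_ge0// muA// two.
have e1 : (2 `^ (b - beta)) ^+ j = (2 ^+ j) `^ b * (2 ^+ j) `^ (- beta) :> R.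
  rewrite -powRD; last by rewrite expf_neq0 ?implybT// pnatr_eq0.
  by rewrite -!powR_mulrn ?powR_ge0// -!powRrM mulrC.
have e2 : c `^ (b - beta) = c `^ b * c `^ (- beta).
  by rewrite -powRD// (gt_eqF c0) implybT.
have pj : 0 <= (2 : R) ^+ j by rewrite exprn_ge0.
rewrite -EFinM lee_fin exprS -mulrA e1 e2.
rewrite !powRM ?mulr_ge0 ?(ltW c0)// le_eqVlt; apply/orP; left; apply/eqP; ring.
Qed.
End power_tail.

(** * Lebesgue measure of boxes and cubes *)

Section box_cover.
Context (R : realType).
Local Open Scope ereal_scope.

Let len (a b : R) : R := Num.max 0%R (b - a)%R.
Let len0 a b : (0 <= len a b)%R. Proof. by rewrite le_max lexx. Qed.

Let integral_itv (a b : R) : \int[lebesgue_measure]_x (\1_(`[a, b] : set R) x)%:E = (len a b)%:E.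
Proof.
rewrite integral_indic// setIT /= lebesgue_measure_itv /= lte_fin /len.
case: ltP => ab; first by rewrite -EFinB max_r// subr_ge0 ltW.
by rewrite max_l// subr_le0.
Qed.

(** Induction on the dimension, with the one-dimensional Lebesgue measure doing the
work: the slices at a fixed first coordinate satisfy the hypothesis one dimension
lower, with the weights multiplied by indicators of intervals, and integration over
that coordinate restores the missing side lengths.  The weights are there to make
this induction possible; weights 0 and 1 give the statement about covers. *)
Lemma box_volume_le_weighted n (a b : 'I_n -> R) (A B : nat -> 'I_n -> R)
    (w : nat -> \bar R) (c : R) : (0 <= c)%R -> (forall k, 0 <= w k) ->
  (forall x : 'I_n -> R, (forall i, a i <= x i <= b i)%R ->
     c%:E <= \sum_(k <oo) w k * (\1_[set x | forall i, (A k i <= x i <= B k i)%R] x)%:E) ->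
  (c * \prod_i len (a i) (b i))%:E <= \sum_(k <oo) w k * (\prod_i len (A k i) (B k i))%:E.
Proof.
move=> + w0; elim: n => [|n IH] in a b A B w w0 c * => c0 cover.
  rewrite big_ord0 mulr1.
  have /cover : forall i : 'I_0, (a i <= a i <= b i)%R by case.
  move=> /le_trans; apply; apply: lee_nneseries => k _.
    by rewrite mule_ge0// lee_fin.
  by rewrite big_ord0 lee_wpmul2l// lee_fin indicE; case: (_ \in _).
pose w' t k := w k * (\1_(`[A k ord0, B k ord0] : set R) t)%:E.
have w'0 t k : 0 <= w' t k by rewrite mule_ge0// lee_fin.
pose tl (v : 'I_n.+1 -> R) (i : 'I_n) := v (lift ord0 i).
pose V k := (\prod_i len (tl (A k) i) (tl (B k) i))%R.
have V0 k : (0 <= V k)%R by apply: prodr_ge0.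
have slice t : (c * \prod_i len (tl a i) (tl b i) * \1_(`[a ord0, b ord0] : set R) t)%:E
    <= \sum_(k <oo) w' t k * (V k)%:E.
  rewrite indicE; case: (boolP (t \in _)) => [|_]; last first.
    by rewrite mulr0 nneseries_ge0// => k _ _; rewrite mule_ge0// lee_fin.
  rewrite inE/= in_itv/= mulr1 => tab; apply: IH => // x xab.
  pose y (i : 'I_n.+1) := if unlift ord0 i is Some j then x j else t.
  apply: (@le_trans _ _ (\sum_(k <oo) w k * (\1_[set x | forall i, (A k i <= x i <= B k i)%R] y)%:E)).
    apply: cover => i; rewrite /y; case: unliftP => [j ->|->] //.
    exact: xab.
  apply: lee_nneseries => k _; first by rewrite mule_ge0// lee_fin.
  rewrite /w' -muleA lee_wpmul2l// -EFinM lee_fin !indicE.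
  case: (asboolP (forall i, (A k i <= y i <= B k i)%R)) => [yAB|yAB]; last first.
    by rewrite memNset// mulr_ge0.
  rewrite [x \in _]mem_set; last by move=> i; have := yAB (lift ord0 i); rewrite /y liftK.
  rewrite [t \in _]mem_set; last by have := yAB ord0; rewrite /y unlift_none /= in_itv.
  by rewrite mulr1; case: (_ \in _).
have mw' k : measurable_fun setT (fun t => w' t k * (V k)%:E).
  apply: emeasurable_funM; last exact: measurable_cst.
  apply: emeasurable_funM; first exact: measurable_cst.
  by apply/measurable_EFinP; exact: measurable_indic.
have := @ge0_le_integral _ _ R lebesgue_measure setT measurableT _ _ _ _ _ (fun t _ => slice t).
move=> H; have {H} := H _ _ _.
rewrite integral_nneseries//; last by move=> k t _; rewrite mule_ge0// lee_fin.
rewrite (_ : \int[_]_(_ in _) _ = (c * \prod_i len (a i) (b i))%:E); last first.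
  under eq_integral do rewrite EFinM.
  rewrite ge0_integralZl_EFin//; last 2 first.
  - by apply/measurable_EFinP; exact: measurable_indic.
  - by rewrite mulr_ge0// prodr_ge0.
  by rewrite integral_itv -EFinM big_ord_recl mulrAC mulrA.
rewrite (eq_eseriesr (g := fun k => w k * (\prod_i len (A k i) (B k i))%:E)); last first.
  move=> k _; rewrite /w'; under eq_integral do rewrite -muleA.
  rewrite ge0_integralZl//; last 2 first.
  - apply/measurable_EFinP/measurable_funM => //; exact: measurable_indic.
  - by move=> t _; rewrite lee_fin mulr_ge0.
  congr (_ * _); under eq_integral do rewrite muleC.
  rewrite ge0_integralZl_EFin ?integral_itv//; last first.
    by apply/measurable_EFinP; exact: measurable_indic.
  by rewrite -EFinM big_ord_recl mulrC.
apply.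
- by move=> t _; rewrite lee_fin !mulr_ge0// prodr_ge0.
- apply/measurable_EFinP/measurable_funM; first exact: measurable_cst.
  exact: measurable_indic.
- apply: ge0_emeasurable_sum => [k t _ _|k _]; first by rewrite mule_ge0// lee_fin.
  exact: mw'.
Qed.

End box_cover.

Section lebesgue.
Context (R : realType) (n : nat).
Local Open Scope ereal_scope.
Local Notation lambda := (@lebesgue_measure_rV R n).

Lemma box_volume_split (ab : 'rV[R]_n * 'rV[R]_n) (i : 'I_n) (c : R) :
  box_volume ab =
    box_volume (ab.1, \row_j (if j == i then Num.min (ab.2 0 j) c else ab.2 0 j)%R) +
    box_volume (\row_j (if j == i then Num.max (ab.1 0 j) c else ab.1 0 j)%R, ab.2).
Proof.
rewrite /box_volume -EFinD; congr (_%:E).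
have D1 (g : 'I_n -> R) : (\prod_j g j = g i * \prod_(j | j != i) g j)%R by exact: bigD1.
rewrite 3!D1 /= !mxE eqxx.
rewrite [X in (_ * X + _)%R](_ : _ = \prod_(j | j != i) Num.max 0 (ab.2 0 j - ab.1 0 j))%R; last first.
  by apply: eq_bigr => j /negbTE ji; rewrite !mxE ji.
rewrite [X in (_ + _ * X)%R](_ : _ = \prod_(j | j != i) Num.max 0 (ab.2 0 j - ab.1 0 j))%R; last first.
  by apply: eq_bigr => j /negbTE ji; rewrite !mxE ji.
rewrite -mulrDl; congr (_ * _)%R.
move: (ab.1 _ i) (ab.2 _ i) => a b.
rewrite /Num.max /Num.min; case: (ltP b c) => bc; case: (ltP a c) => ac; rewrite !subr_gt0.
all: repeat case: ltP => ?; lra.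
Qed.

(** Carathéodory's criterion: a half-space cuts every box of a cover into two boxes
whose volumes add up. *)
Lemma measurable_halfspace (i : 'I_n) (c : R) :
  measurable ([set x | (c <= x 0 i)%R] : set (lebesgue_rV R n)).
Proof.
apply: le_caratheodory_measurable => Y /=.
apply: le_ereal_inf_tmp => _ [F [_ YF] <-].
pose F1 k := omap (fun ab : 'rV[R]_n * 'rV[R]_n =>
  (ab.1, \row_j (if j == i then Num.min (ab.2 0 j) c else ab.2 0 j)%R)) (F k).
pose F2 k := omap (fun ab : 'rV[R]_n * 'rV[R]_n =>
  (\row_j (if j == i then Num.max (ab.1 0 j) c else ab.1 0 j)%R, ab.2)) (F k).
have cost0 o : 0 <= oapp (@box_volume R n) 0 o.
  by case: o => //= ab; exact: box_volume_ge0.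
have -> : \sum_(k <oo) oapp (@box_volume R n) 0 (F k) =
    \sum_(k <oo) oapp (@box_volume R n) 0 (F2 k) +
    \sum_(k <oo) oapp (@box_volume R n) 0 (F1 k).
  rewrite -nneseriesD//; apply: eq_eseriesr => k _; rewrite /F1 /F2.
  by case: (F k) => [ab|]/=; rewrite ?adde0// addeC -box_volume_split.
apply: leeD; apply: ereal_inf_lbound.
- exists F2 => //; split=> [k|x [Yx /= cx]]; first by case: (F2 k).
  have [k _ Fkx] := YF x Yx; exists k => //.
  move: Fkx; rewrite /F2; case: (F k) => //= ab abx j.
  rewrite mxE; case: eqP => [->|_]; last exact: abx.
  by rewrite ge_max cx andbT; exact: abx.
- exists F1 => //; split=> [k|x [Yx /= /negP]]; first by case: (F1 k).
  rewrite -ltNge => /ltW xc.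
  have [k _ Fkx] := YF x Yx; exists k => //.
  move: Fkx; rewrite /F1; case: (F k) => //= ab abx j.
  rewrite mxE; case: eqP => [->|_]; last exact: abx.
  by rewrite le_min xc andbT; exact: abx.
Qed.

Lemma measurable_coord (i : 'I_n) :
  measurable_fun [set: lebesgue_rV R n] (fun x : lebesgue_rV R n => (x : 'rV[R]_n) 0%R i).
Proof.
apply: (measurability (@RGenCInfty.G R)) => [|/= _ [_] [r] -> <-].
  exact: RGenCInfty.measurableE.
rewrite setTI (_ : _ @^-1` _ = [set x | (r <= (x : 'rV[R]_n) 0 i)%R]).
  exact: measurable_halfspace.
by apply/seteqP; split=> x /=; rewrite in_itv/= andbT.
Qed.

Lemma lebesgue_box (ab : 'rV[R]_n * 'rV[R]_n) : lambda (box ab) = box_volume ab.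
Proof.
apply/eqP; rewrite eq_le; apply/andP; split.
  apply: ereal_inf_lbound => /=.
  exists (fun k => if k == 0%N then Some ab else None).
    by split=> [[]//|x abx]; exists 0%N.
  rewrite (nneseriesD1 (n := 0%N))//=; last first.
    by move=> [|k] _//=; exact: box_volume_ge0.
  by rewrite eseries0 ?adde0// => -[].
apply: le_ereal_inf_tmp => _ [F [_ abF] <-].
pose w k : \bar R := if F k is Some _ then 1 else 0.
pose A k (i : 'I_n) := oapp (fun ab : 'rV[R]_n * 'rV[R]_n => ab.1 0 i)%R 0%R (F k).
pose B k (i : 'I_n) := oapp (fun ab : 'rV[R]_n * 'rV[R]_n => ab.2 0 i)%R 0%R (F k).
have w0 k : 0 <= w k by rewrite /w; case: (F k).
have := @box_volume_le_weighted R n (ab.1 ord0) (ab.2 ord0) A B w 1%R ler01 w0.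
rewrite mul1r (eq_eseriesr (g := fun k => oapp (@box_volume R n) 0 (F k))); last first.
  by move=> k _; rewrite /w /A /B; case: (F k) => [cd|]/=; rewrite ?mul1e// mul0e.
apply=> x xab.
have [|k _ Fkx] := abF (\row_i x i); first by move=> i; rewrite mxE.
pose f k := w k * (\1_[set x | forall i, (A k i <= x i <= B k i)%R] x)%:E.
have f0 j : 0 <= f j by rewrite mule_ge0// lee_fin.
apply: (@le_trans _ _ (f k)); last exact: nneseries_ge_term.
move: Fkx; rewrite /f /w /A /B; case: (F k) => //= cd cdx.
rewrite mul1e lee_fin indicE mem_set//= => i.
by have := cdx i; rewrite mxE.
Qed.

Lemma rV_normP (x : 'rV[R]_n) (r : R) : (0 <= r)%R ->
  (`|x| <= r)%R <-> forall i, (`|x 0 i| <= r)%R.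
Proof.
have -> : `|x|%R = (\big[Num.max/0]_ij `|x ij.1 ij.2|)%R by exact: mx_normrE.
move=> r0; split=> [/bigmax_leP[_ xr] i|xr].
  exact: (xr (0, i)%R).
by apply/bigmax_leP; split=> // -[i j] _ /=; rewrite ord1.
Qed.

Lemma cubeE (x : 'rV[R]_n) (r : R) : (0 <= r)%R ->
  cube x r = box (\row_i (x 0 i - r), \row_i (x 0 i + r))%R.
Proof.
move=> r0; apply/seteqP; split=> y /=.
  move=> /rV_normP => /(_ r0) xy i; have := xy i.
  by rewrite !mxE distrC ler_distl.
move=> xy; apply/rV_normP => // i; have := xy i.
by rewrite !mxE distrC ler_distl.
Qed.

Lemma lebesgue_cube (x : 'rV[R]_n) (r : R) : (0 <= r)%R ->
  lambda (cube x r) = ((2 * r) ^+ n)%:E.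
Proof.
move=> r0; rewrite cubeE// lebesgue_box /box_volume; congr (_%:E).
rewrite -[in RHS](card_ord n) -prodr_const; apply: eq_bigr => i _.
rewrite !mxE/= (_ : x 0 i + r - (x 0 i - r) = 2 * r)%R; last by ring.
by rewrite max_r// mulr_ge0.
Qed.

Lemma measurable_cube (x : 'rV[R]_n) (r : R) :
  measurable (cube x r : set (lebesgue_rV R n)).
Proof.
have [r0|r0] := leP 0%R r; last first.
  rewrite (_ : cube x r = set0)//; apply/seteqP; split=> y //=.
  by rewrite /cube/= leNgt (lt_le_trans r0).
rewrite cubeE// (_ : box _ = \bigcap_(i in [set: 'I_n])
    [set y | (x 0 i - r <= y 0 i <= x 0 i + r)%R]).
  apply: fin_bigcap_measurable; first exact: finite_finset.
  move=> i _.
  rewrite [X in measurable X](_ : _ = (fun y : lebesgue_rV R n => (y : 'rV[R]_n) 0%R i)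
     @^-1` `[(x 0 i - r)%R, (x 0 i + r)%R]).
    by rewrite -[X in measurable X]setTI; exact: measurable_coord.
  by apply/seteqP; split=> y /=; rewrite in_itv.
apply/seteqP; split=> y /=.
  by move=> xy i _; have := xy i; rewrite !mxE.
by move=> xy i; have := xy i I; rewrite !mxE.
Qed.

Lemma lebesgue_rV_sigma_finite : sigma_finite [set: lebesgue_rV R n] lambda.
Proof.
exists (fun k => cube 0%R k%:R).
  apply/esym/seteqP; split=> // x _.
  exists (Num.truncn `|x|).+1 => //; rewrite /cube/= sub0r normrN.
  by rewrite ltW// truncnS_gt.
move=> k; split; first exact: measurable_cube.
by rewrite [X in X < _]lebesgue_cube// ltry.
Qed.

Lemma measurable_dist :
  measurable_fun [set: lebesgue_rV R n * lebesgue_rV R n]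
    (fun z : lebesgue_rV R n * lebesgue_rV R n => `|(z.1 : 'rV[R]_n) - z.2|%R).
Proof.
have -> : (fun z : lebesgue_rV R n * lebesgue_rV R n => `|(z.1 : 'rV[R]_n) - z.2|%R) =
  (fun z => \big[Num.max/0%R]_(ij <- index_enum ('I_1 * 'I_n)%type)
     `|(z.1 : 'rV[R]_n) ij.1 ij.2 - (z.2 : 'rV[R]_n) ij.1 ij.2|%R).
  apply/funext => z.
  transitivity (mx_norm ((z.1 : 'rV[R]_n) - z.2))%R => //.
  by rewrite mx_normrE; apply: eq_bigr => ij _; rewrite !mxE.
elim: (index_enum _) => [|[i j] s IH].
  by under eq_fun do rewrite big_nil; exact: measurable_cst.
under eq_fun do rewrite big_cons.
apply: measurable_maxr => //; rewrite ord1 /=.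
apply: measurableT_comp => //; apply: measurable_funB.
  exact: (measurableT_comp (measurable_coord j) measurable_fst).
exact: (measurableT_comp (measurable_coord j) measurable_snd).
Qed.

(** An open set is the union of the rational boxes that it contains.  The product with
the line is what the joint measurability in the centre and the radius of a cube
requires. *)
Lemma measurable_open_prod (W : set (R * 'rV[R]_n)) :
  (forall t x, W (t, x) -> exists2 r : R, (0 < r)%R &
     forall t' x', (`|t - t'| < r)%R -> (`|x - x'| < r)%R -> W (t', x')) ->
  measurable (W : set (measurableTypeR R * lebesgue_rV R n)).
Proof.
move=> Wo.
pose c (q : 'rV[rat]_n) : 'rV[R]_n := map_mx ratr q.
pose V (i : rat * 'rV[rat]_n * rat) : set (measurableTypeR R * lebesgue_rV R n) :=
  `[(ratr i.1.1 - ratr i.2)%R, (ratr i.1.1 + ratr i.2)%R]%classic `*` cube (c i.1.2) (ratr i.2).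
pose W' i := [set z | V i z /\ V i `<=` W].
have -> : W = \bigcup_i W' i.
  apply/seteqP; split=> [[t x] Wtx|z [i _ [Viz ViW]]]; last exact: ViW.
  have [r r0 Wr] := Wo t x Wtx.
  have /rat_in_itvoo[e] : (0 < r / 2)%R by rewrite divr_gt0.
  rewrite in_itv/= => /andP[e0 er].
  have approx (y : R) : {q : rat | (`|ratr q - y| <= ratr e)%R}.
    apply: cid; have /rat_in_itvoo[q] : (y - ratr e < y + ratr e)%R.
      by rewrite ltrD2l gtrN.
    by rewrite in_itv/= => yq; exists q; rewrite ler_distl; lra.
  exists (projT1 (approx t), \row_i projT1 (approx (x 0 i)), e)%R => //.
  have tq := projT2 (approx t).
  have xq : (`|c (\row_i projT1 (approx (x ord0 i))) - x| <= ratr e)%R.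
    apply/rV_normP; first exact: ltW.
    by move=> i; rewrite !mxE; exact: (projT2 (approx (x ord0 i))).
  split; first by split=> //=; rewrite in_itv/= -ler_distl distrC.
  move=> [t' x'] [/=]; rewrite in_itv/= -ler_distl => tq' xq'.
  apply: Wr.
    rewrite (le_lt_trans (ler_distD (ratr (projT1 (approx t))) _ _))//.
    rewrite [X in (X + _)%R]distrC [X in (_ + X)%R]distrC; lra.
  rewrite (le_lt_trans (ler_distD (c (\row_i projT1 (approx (x ord0 i)))) _ _))//.
  rewrite /cube/= in xq'.
  rewrite [X in (X + _)%R]distrC; lra.
apply: countable_bigcupT_measurable => // i.
have [ViW|ViW] := pselect (V i `<=` W).
  rewrite (_ : W' i = V i); last by apply/seteqP; split=> z // [].
  apply: measurableX; first exact: measurable_itv.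
  exact: measurable_cube.
by rewrite (_ : W' i = set0)//; apply/seteqP; split=> z // [].
Qed.

Lemma measurable_open (O : set 'rV[R]_n) : open O ->
  measurable (O : set (lebesgue_rV R n)).
Proof.
move=> oO.
have mO : measurable ([set: R] `*` O : set (measurableTypeR R * lebesgue_rV R n)).
  apply: measurable_open_prod => t x [_ /= Ox].
  have /nbhs_ballP[r /= r0 rO] := open_nbhs_nbhs (conj oO Ox).
  exists r => // t' x' _ xx'; split => //=; apply: rO.
  by rewrite -ball_normE.
have := measurable_xsection (0%R : measurableTypeR R) mO.
rewrite (_ : xsection _ _ = O)//.
by apply/seteqP; split=> x; rewrite /xsection/= inE => // -[].
Qed.

End lebesgue.

(** * The boundary kernel *)

Section kernel.
Local Open Scope ereal_scope.
Context d (T : measurableType d) (R : realType).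
Context (mu : {sigma_finite_measure set T -> \bar R}).
Variables (dist : T -> T -> R) (delta : T -> R) (A b alpha : R).
Hypotheses (mdist : measurable_fun [set: T * T] (fun z => dist z.1 z.2))
  (mdelta : measurable_fun [set: T] delta).
Hypotheses (dist_ge0 : forall x y, (0 <= dist x y)%R)
  (distC : forall x y, dist x y = dist y x)
  (dist_triangle : forall x y z, (dist x z <= dist x y + dist y z)%R)
  (delta_ge0 : forall y, (0 <= delta y)%R).
Hypotheses (b0 : (0 <= b)%R) (alpha0 : (0 < alpha)%R).
Hypothesis mu_ball : forall y r, (0 < r)%R ->
  mu [set x | (dist x y <= r)%R] <= (A * r `^ b)%:E.

(** When [delta] is the distance to a set: up to constants, the radius of the smallest
ball around [x] that contains [y] and the point of the set nearest to [y]. *)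
Definition bgauge x y : R := (delta y + dist x y)%R.

(** Up to a constant, the kernel of the sum over the dyadic radii [r] of the averages
over the balls of radius [r] around [x], weighted by [(delta y / r)^alpha] and
restricted to [bgauge x y <= r].  It vanishes where [delta] does, since
[alpha > 0]. *)
Definition bkernel x y : R := (delta y `^ alpha * bgauge x y `^ (- (b + alpha)))%R.

Definition potential (H : T -> \bar R) (x : T) : \bar R :=
  \int[mu]_y ((bkernel x y)%:E * H y).

Let bkernel_ge0 x y : (0 <= bkernel x y)%R. Proof. by rewrite mulr_ge0 ?powR_ge0. Qed.

Let bkernel0 x y : delta y = 0%R -> bkernel x y = 0%R.
Proof. by move=> dy; rewrite /bkernel dy powR0 ?mul0r// gt_eqF. Qed.

Let krho_delta x y : (delta y <= bgauge x y)%R. Proof. by rewrite lerDl. Qed.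
Let krho_ge0 x y : (0 <= bgauge x y)%R. Proof. by rewrite addr_ge0. Qed.

Let mbgauge : measurable_fun [set: T * T] (fun z => bgauge z.1 z.2).
Proof.
apply: measurable_funD => //.
exact: (measurableT_comp mdelta measurable_snd).
Qed.

Let mbkernel : measurable_fun [set: T * T] (fun z => (bkernel z.1 z.2)%:E).
Proof.
apply/measurable_EFinP; apply: measurable_funM.
  apply: (measurableT_comp (measurable_powR alpha)).
  exact: (measurableT_comp mdelta measurable_snd).
exact: (measurableT_comp (measurable_powR _) mbgauge).
Qed.

Let mbkernelr x : measurable_fun [set: T] (fun y => (bkernel x y)%:E).
Proof. exact: (measurableT_comp mbkernel (pair1_measurable x)). Qed.
Let mbkernell y : measurable_fun [set: T] (fun x => (bkernel x y)%:E).
Proof. exact: (measurableT_comp mbkernel (pair2_measurable y)). Qed.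
Let mbgauger x : measurable_fun [set: T] (fun y => bgauge x y).
Proof. exact: (measurableT_comp mbgauge (pair1_measurable x)). Qed.
Let mdistl y : measurable_fun [set: T] (fun x => dist x y).
Proof. exact: (measurableT_comp mdist (pair2_measurable y)). Qed.

Section potential_of_nonneg.
Variable H : T -> \bar R.
Hypotheses (mH : measurable_fun [set: T] H) (H0 : forall y, 0 <= H y).

Let mprod : measurable_fun [set: T * T] (fun z => (bkernel z.1 z.2)%:E * H z.2).
Proof.
apply: emeasurable_funM => //.
exact: (measurableT_comp mH measurable_snd).
Qed.

Let prod0 x y : 0 <= (bkernel x y)%:E * H y.
Proof. by rewrite mule_ge0// lee_fin. Qed.

Let mprodr x : measurable_fun [set: T] (fun y => (bkernel x y)%:E * H y).
Proof. exact: emeasurable_funM. Qed.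

Lemma potential_ge0 x : 0 <= potential H x. Proof. exact: integral_ge0. Qed.

Lemma measurable_potential : measurable_fun [set: T] (potential H).
Proof. exact: (measurable_fun_fubini_tonelli_F (m2 := mu) _ mprod). Qed.

Definition bkernel_mass := (A * 2 `^ b / (1 - 2 `^ (- alpha)))%R.

Lemma bkernel_mass_ge0 (y : T) : (0 <= bkernel_mass)%R.
Proof.
have A0 : (0 <= A)%R.
  have := le_trans (measure_ge0 mu _) (mu_ball y (@ltr01 R)).
  by rewrite lee_fin powR1 mulr1.
rewrite divr_ge0 ?mulr_ge0 ?powR_ge0// subr_ge0.
by rewrite powRN invf_le1 ?powR_gt0// -[leLHS](powRr0 2) ler_powR ?ler1n// ltW.
Qed.

(** The bound is independent of [y] since the power [delta y ^ alpha] compensates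
exactly the tail of [(delta y + dist x y)^(-b-alpha)]. *)
Lemma integral_bkernel y : \int[mu]_x (bkernel x y)%:E <= bkernel_mass%:E.
Proof.
have [dy|dy] := eqVneq (delta y) 0%R.
  by under eq_integral do rewrite bkernel0//; rewrite integral0 lee_fin (bkernel_mass_ge0 y).
have dy0 : (0 < delta y)%R by rewrite lt_neqAle eq_sym dy delta_ge0.
have mu_ball' r : (0 < r)%R -> mu (setT `&` [set x | (dist x y <= r)%R]) <= (A * r `^ b)%:E.
  by move=> r0; rewrite setTI mu_ball.
have := @integral_power_tail _ _ _ mu setT measurableT (dist ^~ y) A b (mdistl y)
  (fun x _ => dist_ge0 x y) mu_ball' (delta y) (b + alpha) b0 _ dy0.
rewrite ltrDl => /(_ alpha0).
rewrite (_ : b - (b + alpha) = - alpha)%R; last by ring.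
move=> sh.
under eq_integral do rewrite EFinM.
rewrite ge0_integralZl_EFin//; last 3 first.
- by move=> x _; rewrite lee_fin powR_ge0.
- apply/measurable_EFinP.
  exact: (measurableT_comp (measurable_powR _) (measurableT_comp mbgauge (pair2_measurable y))).
- exact: powR_ge0.
apply: (@le_trans _ _ ((delta y `^ alpha)%:E * (bkernel_mass * delta y `^ (- alpha))%:E)).
  by rewrite lee_wpmul2l// lee_fin powR_ge0.
by rewrite -EFinM lee_fin mulrCA powRN mulfV ?mulr1// gt_eqF ?powR_gt0.
Qed.

Lemma integral_potential : \int[mu]_x potential H x <= bkernel_mass%:E * \int[mu]_y H y.
Proof.
rewrite (fubini_tonelli (m1 := mu) (m2 := mu) _ mprod)//=.
rewrite -ge0_integralZl//; last by rewrite lee_fin (bkernel_mass_ge0 point).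
apply: ge0_le_integral => //.
- by move=> y _; apply: integral_ge0.
- exact: (measurable_fun_fubini_tonelli_G (m1 := mu) _ mprod).
- exact: measurable_funeM.
move=> y _; under eq_integral do rewrite muleC.
rewrite ge0_integralZl//; last by move=> x _; rewrite lee_fin.
by rewrite muleC lee_wpmul2r// integral_bkernel.
Qed.

(** By the triangle inequality [bgauge y z <= bgauge x y + bgauge x z], hence the
constant [3]. *)
Lemma bkernel_comparable x y z : (bgauge x y <= 2 * bgauge x z)%R ->
  (bkernel x z <= 3 `^ (b + alpha) * bkernel y z)%R.
Proof.
move=> rr; have [dz|dz] := eqVneq (delta z) 0%R; first by rewrite !bkernel0// mulr0.
have dz0 : (0 < delta z)%R by rewrite lt_neqAle eq_sym dz delta_ge0.
have r0 w : (0 < bgauge w z)%R by rewrite (lt_le_trans dz0).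
rewrite /bkernel mulrCA ler_wpM2l ?powR_ge0//.
have ryz : (bgauge y z <= 3 * bgauge x z)%R.
  rewrite /bgauge in rr r0 *.
  have := dist_triangle y x z; rewrite (distC y x); have := delta_ge0 y; lra.
apply: (@le_trans _ _ (3 `^ (b + alpha) * (3 * bgauge x z) `^ (- (b + alpha)))%R).
  rewrite (powRM _ _ (ltW (r0 _)))// mulrA -powRD; last by rewrite pnatr_eq0 implybT.
  by rewrite subrr powRr0 mul1r.
by rewrite ler_wpM2l ?powR_ge0// powR_leN// addr_ge0// ltW.
Qed.

Let k3 := (3 `^ (b + alpha))%R.
Let k3_gt0 : (0 < k3)%R. Proof. by rewrite powR_gt0. Qed.

Let mfar x y : measurable [set z | (bgauge x y <= 2 * bgauge x z)%R].
Proof.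
rewrite -[X in measurable X]setTI; apply: (measurable_fun_le (D := setT)) => //.
exact: measurable_funM.
Qed.

(** On this domain of integration [bkernel_comparable] replaces [x] by [y] in the
kernel. *)
Lemma potential_far x y :
  \int[mu]_(z in [set z | (bgauge x y <= 2 * bgauge x z)%R]) ((bkernel x z)%:E * H z)
    <= k3%:E * potential H y.
Proof.
have mF := mfar x y.
rewrite -ge0_integralZl//; last by rewrite lee_fin ltW.
rewrite [leLHS]integral_mkcond.
apply: ge0_le_integral => //.
- by move=> z _; rewrite patchE; case: ifP.
- by apply/(measurable_restrictT _ mF); exact: measurable_funTS.
- exact: measurable_funeM.
move=> z _; rewrite patchE; case: ifPn => [|_]; last by rewrite mule_ge0// lee_fin ltW.
rewrite inE/= => rr; rewrite muleA lee_wpmul2r// -EFinM lee_fin.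
exact: bkernel_comparable.
Qed.

(** Among the points of the domain of integration choose [y0] with almost minimal
gauge: the others have gauge at least half of that of [y0], so that [potential_far] at
[y0] bounds their mass by a multiple of the potential at [y0].  The vanishing of [H]
where [delta < eps] allows restriction to gauges at least [eps]; their infimum is then
positive, hence attained up to the factor 2. *)
Lemma potential_sublevel_mass (eps : R) x (m : R) : (0 < eps)%R ->
  (forall y, (delta y < eps)%R -> H y = 0) -> (0 <= m)%R ->
  \int[mu]_(y in [set y | k3%:E * potential H y < m%:E]) ((bkernel x y)%:E * H y) <= m%:E.
Proof.
move=> eps0 Heps m0; set U := [set y | _].
have mU : measurable U.
  rewrite -[U]setTI; apply: (emeasurable_fun_lt (D := setT)) => //.
  by apply: measurable_funeM; exact: measurable_potential.
pose U' := U `&` [set y | (eps <= delta y)%R].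
have [[y1 U'y1]|U'0] := pselect (U' !=set0); last first.
  rewrite integral0_eq// => y Uy; case: (ltP (delta y) eps) => dy.
    by rewrite Heps// mule0.
  by case: U'0; exists y.
pose E := [set bgauge x y | y in U'].
have hE : has_inf E.
  split; first by exists (bgauge x y1), y1.
  by exists 0%R => _ [y _ <-].
have infE : (eps <= inf E)%R.
  apply: lb_le_inf; first by exists (bgauge x y1), y1.
  by move=> _ [y [_ /= dy] <-]; rewrite (le_trans dy).
have infE0 : (0 < inf E)%R by exact: lt_le_trans infE.
have [_ [y0 [Uy0 dy0] <-]] := inf_adherent infE0 hE.
move=> ry0.
apply: (le_trans _ (ltW Uy0)); apply: le_trans (potential_far x y0).
rewrite integral_mkcond [leRHS]integral_mkcond; apply: ge0_le_integral => //.
- by move=> z _; rewrite patchE; case: ifP.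
- by apply/(measurable_restrictT _ mU); exact: measurable_funTS.
- by apply/(measurable_restrictT _ (mfar x y0)); exact: measurable_funTS.
move=> z _; rewrite !patchE; case: ifPn => [|_]; last by case: ifP.
rewrite inE => Uz; case: (ltP (delta z) eps) => dz.
  by rewrite Heps// mule0; case: ifP.
rewrite mem_set//=.
have : (inf E <= bgauge x z)%R by apply: ge_inf; [case: hE|exists z].
lra.
Qed.

(** With [m] the total mass, at least half of it lies outside the set of
[potential_sublevel_mass] for [m / 2], and there the potential is at least a constant
times [m]. *)
Lemma potential_self_improving (P eps : R) x : (1 <= P)%R -> (0 < eps)%R ->
  (forall y, (delta y < eps)%R -> H y = 0) -> potential H x < +oo ->
  potential H x `^ P <= (2 * (2 * k3) `^ (P - 1))%:E *
                  potential (fun y => H y * potential H y `^ (P - 1)) x.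
Proof.
move=> P1 eps0 Heps fx.
have P0 : (0 < P)%R by rewrite (lt_le_trans ltr01).
have mp := measurable_potential.
have [m potm] : exists m : R, potential H x = m%:E.
  by exists (fine (potential H x)); rewrite fineK// ge0_fin_numE// potential_ge0.
have m0 : (0 <= m)%R by rewrite -lee_fin -potm potential_ge0.
pose U := [set y | k3%:E * potential H y < (m / 2)%:E].
have mU : measurable U.
  rewrite -[U]setTI; apply: (emeasurable_fun_lt (D := setT)) => //.
  exact: measurable_funeM.
have HU : \int[mu]_(y in U) ((bkernel x y)%:E * H y) <= (m / 2)%:E.
  by apply: (potential_sublevel_mass (eps := eps)) => //; rewrite divr_ge0.
have HUC : (m / 2)%:E <= \int[mu]_(y in ~` U) ((bkernel x y)%:E * H y).
  have : potential H x = \int[mu]_(y in U) ((bkernel x y)%:E * H y) +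
                   \int[mu]_(y in ~` U) ((bkernel x y)%:E * H y).
    rewrite /potential -(setUv U) ge0_integral_setU//; first exact: measurableC.
      exact: measurable_funTS.
    exact/disj_setPCl.
  rewrite potm => mE; rewrite -(leeD2lE (x := (m / 2)%:E))//.
  by rewrite -EFinD -splitr mE leeD2r.
set D := (2 * _)%R; rewrite potm poweR_EFin.
have -> : (m `^ P)%:E = D%:E * ((m / (2 * k3)) `^ (P - 1))%:E * (m / 2)%:E.
  rewrite -!EFinM; congr (_%:E); rewrite /D.
  have k2 : (0 < 2 * k3)%R by rewrite mulr_gt0.
  rewrite -[X in (X * (m / 2))%R]mulrA -powRM ?divr_ge0 ?(ltW k2)//.
  rewrite (mulrC m) mulVKf ?gt_eqF// -(mulr_powRB1 m0 P0).
  by field.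
rewrite -muleA lee_wpmul2l//; first by rewrite lee_fin mulr_ge0 ?powR_ge0.
apply: (@le_trans _ _ (((m / (2 * k3)) `^ (P - 1))%:E *
    \int[mu]_(y in ~` U) ((bkernel x y)%:E * H y))).
  by rewrite lee_wpmul2l// lee_fin powR_ge0.
have mHP : measurable_fun setT (fun y => (bkernel x y)%:E * (H y * potential H y `^ (P - 1))).
  apply: emeasurable_funM => //; apply: emeasurable_funM => //.
  exact: (measurableT_comp (measurable_poweR _) mp).
rewrite -ge0_integralZl//; last 3 first.
- exact: measurableC.
- exact: measurable_funTS.
- by rewrite lee_fin powR_ge0.
rewrite [leLHS]integral_mkcond; apply: ge0_le_integral => //.
- by move=> y _; rewrite patchE; case: ifP => // _; rewrite mule_ge0// lee_fin powR_ge0.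
- apply/(measurable_restrictT _ (measurableC mU)); apply: measurable_funTS.
  exact: measurable_funeM.
move=> y _; rewrite patchE; case: ifPn => [|_]; last first.
  by rewrite mule_ge0 ?lee_fin// mule_ge0// poweR_ge0.
rewrite inE => /negP; rewrite -leNgt => yU.
rewrite muleCA lee_wpmul2l ?lee_fin// muleC lee_wpmul2l//.
rewrite -poweR_EFin; apply: poweR_le.
- by rewrite subr_ge0.
- by rewrite lee_fin divr_ge0// mulr_ge0// ltW.
by rewrite invfM mulrA EFinM lee_pdivrMr// muleC.
Qed.
End potential_of_nonneg.

(** This and the integrability of [H] make the potential of a truncated [H] bounded. *)
Lemma bkernel_le (eps : R) x y : (0 < eps)%R -> (eps <= delta y)%R ->
  (bkernel x y <= eps `^ (- b))%R.
Proof.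
move=> eps0 epsd; have d0 := lt_le_trans eps0 epsd.
have r0 : (0 < bgauge x y)%R by rewrite (lt_le_trans d0).
rewrite /bkernel opprD powRD; last by rewrite (gt_eqF r0) implybT.
rewrite mulrCA -[leRHS]mulr1; apply: ler_pM; rewrite ?powR_ge0//.
- by rewrite mulr_ge0 ?powR_ge0.
- by rewrite powR_leN// (le_trans epsd).
- by rewrite powRN ler_pdivrMr ?powR_gt0// mul1r powR_le// ltW.
Qed.

(** The constant in [int (T H)^P <= D * int H (T H)^(P-1)]. *)
Let Dcst (P : R) := (2 * (2 * 3 `^ (b + alpha)) `^ (P - 1) * bkernel_mass)%R.
Definition potential_Lp_cst (P : R) := (2 * ((2 * Dcst P) `^ (P - 1) * Dcst P))%R.

Let Dcst_ge0 P : (0 <= Dcst P)%R.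
Proof. by rewrite mulr_ge0 ?(bkernel_mass_ge0 point)// mulr_ge0 ?powR_ge0. Qed.

Lemma potential_Lp_cst_ge0 P : (0 <= potential_Lp_cst P)%R.
Proof. by rewrite mulr_ge0// mulr_ge0 ?powR_ge0. Qed.

(** The truncation of [H] makes the integral of the [P]-th power of the potential
finite, so that half of it can be moved to the left after [young_absorb]. *)
Lemma potential_Lp_truncated (H : T -> R) (P eps : R) : (1 <= P)%R -> (0 < eps)%R ->
  measurable_fun [set: T] H -> (forall y, 0 <= H y)%R ->
  (forall y, (delta y < eps)%R -> H y = 0%R) -> \int[mu]_y (H y)%:E < +oo ->
  \int[mu]_x (potential (EFin \o H) x `^ P) <= (potential_Lp_cst P)%:E * \int[mu]_y (H y `^ P)%:E.
Proof.
move=> P1 eps0 mH H0 Heps intH; set v := potential _.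
have P0 : (0 < P)%R by rewrite (lt_le_trans ltr01).
have mEH : measurable_fun [set: T] (EFin \o H) by exact/measurable_EFinP.
have EH0 y : 0 <= (EFin \o H) y by rewrite lee_fin.
have mv : measurable_fun setT v by exact: measurable_potential.
have v0 x : 0 <= v x by exact: potential_ge0.
have mvp r : measurable_fun setT (fun x => v x `^ r).
  exact: (measurableT_comp (measurable_poweR _) mv).
have iH : \int[mu]_y (H y)%:E \is a fin_num by rewrite ge0_fin_numE//; apply: integral_ge0 => y _; exact: EH0.
pose B := (eps `^ (- b) * fine (\int[mu]_y (H y)%:E))%R.
have vB x : v x <= B%:E.
  rewrite /B EFinM fineK// -ge0_integralZl//; last 2 first.
  - by move=> y _; exact: EH0.
  - by rewrite lee_fin powR_ge0.
  apply: ge0_le_integral => //.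
  - by move=> y _; rewrite mule_ge0// lee_fin.
  - exact: emeasurable_funM.
  - exact: measurable_funeM.
  move=> y _; have [dy|dy] := ltP (delta y) eps; first by rewrite /= Heps// !mule0.
  by rewrite lee_wpmul2r ?lee_fin// bkernel_le.
have vfin x : v x < +oo by rewrite (le_lt_trans (vB x))// ltry.
have vM x : v x `^ P = v x `^ (P - 1) * v x.
  have vx : v x \is a fin_num by rewrite ge0_fin_numE.
  rewrite -(fineK vx) !poweR_EFin -EFinM mulrC mulr_powRB1//.
  exact: fine_ge0.
set I := integral _ _ _; set J := integral _ _ _.
have I0 : 0 <= I by apply: integral_ge0 => x _; exact: poweR_ge0.
have I1 : I <= (2 * (2 * 3 `^ (b + alpha)) `^ (P - 1))%:E *
              \int[mu]_x potential (fun y => (H y)%:E * v y `^ (P - 1)) x.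
  have HvE0 y : 0 <= (H y)%:E * v y `^ (P - 1) by rewrite mule_ge0 ?lee_fin ?poweR_ge0.
  have mHv : measurable_fun setT (fun y => (H y)%:E * v y `^ (P - 1)).
    exact: emeasurable_funM.
  rewrite -ge0_integralZl//; last 2 first.
  - exact: measurable_potential.
  - by move=> x _; exact: potential_ge0.
  apply: ge0_le_integral => //.
  - by move=> x _; exact: poweR_ge0.
  - by apply: measurable_funeM; exact: measurable_potential.
  move=> x _; apply: (potential_self_improving mEH EH0 P1 eps0) => //.
  by move=> y dy; rewrite /= Heps.
have I2 : I <= \int[mu]_y (2^-1%:E * v y `^ P +
     ((2 * Dcst P) `^ (P - 1) * Dcst P)%:E * (H y `^ P)%:E).
  apply: (le_trans I1).
  apply: (@le_trans _ _ ((Dcst P)%:E * \int[mu]_y ((H y)%:E * v y `^ (P - 1)))).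
    rewrite /Dcst [in leRHS]EFinM -muleA lee_wpmul2l//.
    apply: integral_potential.
      exact: emeasurable_funM.
    by move=> y; rewrite mule_ge0 ?lee_fin ?poweR_ge0.
  rewrite -ge0_integralZl//; last 3 first.
  - exact: emeasurable_funM.
  - by move=> y _; rewrite mule_ge0 ?lee_fin ?poweR_ge0.
  - by rewrite lee_fin.
  apply: ge0_le_integral => //.
  - by move=> y _; rewrite mule_ge0 ?lee_fin// mule_ge0 ?lee_fin ?poweR_ge0.
  - by apply: measurable_funeM; exact: emeasurable_funM.
  - apply: emeasurable_funD; apply: measurable_funeM => //.
    apply/measurable_EFinP; exact: (measurableT_comp (measurable_powR _) mH).
  move=> y _; have vy : v y \is a fin_num by rewrite ge0_fin_numE.
  rewrite -(fineK vy) !poweR_EFin -!EFinM -EFinD lee_fin.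
  by apply: young_absorb => //; exact: fine_ge0.
have mHP : measurable_fun setT (fun y => (H y `^ P)%:E).
  apply/measurable_EFinP; exact: (measurableT_comp (measurable_powR _) mH).
have HP0 y : 0 <= (H y `^ P)%:E by rewrite lee_fin powR_ge0.
move: I2; rewrite ge0_integralD//; last 4 first.
- by move=> y _; rewrite mule_ge0 ?lee_fin ?poweR_ge0.
- exact: measurable_funeM.
- by move=> y _; rewrite mule_ge0// lee_fin mulr_ge0 ?powR_ge0.
- exact: measurable_funeM.
rewrite ge0_integralZl//; last by move=> y _; exact: poweR_ge0.
rewrite ge0_integralZl//; last by rewrite lee_fin mulr_ge0 ?powR_ge0.
rewrite -/I -/J.
have Ioo : I < +oo.
  have mBv : measurable_fun setT (fun x => (B `^ (P - 1))%:E * v x).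
    exact: measurable_funeM.
  apply: (@le_lt_trans _ _ (\int[mu]_x ((B `^ (P - 1))%:E * v x))).
    apply: ge0_le_integral => //.
    - by move=> x _; exact: poweR_ge0.
    move=> x _; rewrite vM lee_wpmul2r// -poweR_EFin poweR_le ?subr_ge0//.
  rewrite ge0_integralZl//; last by rewrite lee_fin powR_ge0.
  apply: (@le_lt_trans _ _ ((B `^ (P - 1))%:E * (bkernel_mass%:E * \int[mu]_y (H y)%:E))).
    by rewrite lee_wpmul2l ?lee_fin ?powR_ge0// integral_potential.
  by rewrite -(fineK iH) -!EFinM ltry.
have Ifin : I \is a fin_num by rewrite ge0_fin_numE.
have {1}-> : I = 2^-1%:E * I + 2^-1%:E * I.
  rewrite -ge0_muleDl ?lee_fin ?invr_ge0// -EFinD (_ : 2^-1 + 2^-1 = 1)%R ?mul1e//.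
  by field.
rewrite leeD2lE ?fin_numM// => IJ.
have -> : I = 2%:E * (2^-1%:E * I) by rewrite muleA -EFinM mulfV ?mul1e.
by rewrite /potential_Lp_cst EFinM -muleA lee_wpmul2l.
Qed.

Lemma potential_Lp_bounded (H : T -> R) (P : R) : (1 <= P)%R ->
  measurable_fun [set: T] H -> (forall y, 0 <= H y)%R ->
  \int[mu]_x (potential (EFin \o H) x `^ P) <= (potential_Lp_cst P)%:E * \int[mu]_y (H y `^ P)%:E.
Proof.
move=> P1 mH H0.
have P0 : (0 < P)%R by rewrite (lt_le_trans ltr01).
(* Truncation to bounded values, to a bounded region, and away from [delta = 0];
   the points with [delta = 0] are lost in the limit but the kernel vanishes there. *)
pose Z N := [set y | (N.+1%:R^-1 <= delta y)%R /\ (dist y point <= N.+1%:R)%R].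
have mZ N : measurable (Z N).
  rewrite (_ : Z N = [set y | N.+1%:R^-1 <= delta y]%R `&` [set y | dist y point <= N.+1%:R]%R)//.
  by apply: measurableI; rewrite -[X in measurable X]setTI; exact: measurable_fun_le.
pose G N y := (Num.min (H y) N.+1%:R * \1_(Z N) y)%R.
have G0 N y : (0 <= G N y)%R by rewrite mulr_ge0// le_min H0 ler0n.
have mG N : measurable_fun [set: T] (G N).
  by apply: measurable_funM; [exact: measurable_minr|exact: measurable_indic].
have ZS N y : Z N y -> Z N.+1 y.
  move=> [Zd Zx]; split.
    by rewrite (le_trans _ Zd)// lef_pV2 ?posrE ?ltr0n// ler_nat.
  by rewrite (le_trans Zx)// ler_nat.
have Gnd y : nondecreasing_seq (G ^~ y).
  apply/nondecreasing_seqP => N; rewrite /G !indicE; apply: ler_pM => //.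
  - by rewrite le_min H0 ler0n.
  - by rewrite le_min ge_min lexx/= ge_min ler_nat leqnSn orbT.
  - case: (boolP (y \in Z N)) => // yZ; rewrite mem_set//.
    by apply: ZS; rewrite inE in yZ.
have GH N y : (G N y <= H y)%R.
  rewrite /G indicE; case: (_ \in _); rewrite ?mulr0// mulr1.
  by rewrite ge_min lexx.
have Geq y : (0 < delta y)%R -> exists N, forall M, (N <= M)%N -> G M y = H y.
  move=> dy.
  pose N := maxn (Num.truncn (delta y)^-1) (maxn (Num.truncn (dist y point)) (Num.truncn (H y))).
  exists N => M NM.
  have tr (r : R) : (Num.truncn r <= N)%N -> (r <= M.+1%:R)%R.
    move=> rN; rewrite (le_trans (ltW (truncnS_gt r)))// ler_nat ltnS.
    exact: leq_trans NM.
  rewrite /G indicE mem_set ?mulr1 ?min_l//.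
    by apply: tr; rewrite !leq_max leqnn !orbT.
  split; last by apply: tr; rewrite !leq_max leqnn !orbT.
  rewrite -[leRHS]invrK lef_pV2 ?posrE ?invr_gt0 ?ltr0n//.
  by apply: tr; rewrite !leq_max leqnn.
have mEG N : measurable_fun [set: T] (EFin \o G N) by exact/measurable_EFinP.
have EG0 N y : 0 <= (EFin \o G N) y by rewrite lee_fin.
have lim_pot x : limn (fun N => potential (EFin \o G N) x) = potential (EFin \o H) x.
  rewrite /potential -(monotone_convergence mu measurableT).
  - apply: eq_integral => y _; apply/cvg_lim => //.
    have [dy|dy] := eqVneq (delta y) 0%R.
      by rewrite bkernel0// !mul0e; under eq_fun do rewrite mul0e; exact: cvg_cst.
    have [N GN] : exists N, forall M, (N <= M)%N -> G M y = H y.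
      by apply: Geq; rewrite lt_neqAle eq_sym dy delta_ge0.
    apply: cvg_near_cst; exists N => // M /= NM; rewrite GN//.
  - by move=> N; exact: emeasurable_funM.
  - by move=> N y _; rewrite mule_ge0// lee_fin.
  - move=> y _ N M NM; rewrite lee_wpmul2l ?lee_fin//.
    exact: Gnd.
have potnd x : nondecreasing_seq (fun N => potential (EFin \o G N) x).
  move=> N M NM; apply: ge0_le_integral => //.
  - by move=> y _; rewrite mule_ge0// lee_fin.
  - exact: emeasurable_funM.
  - exact: emeasurable_funM.
  - by move=> y _; rewrite lee_wpmul2l ?lee_fin//; exact: Gnd.
have bound N : \int[mu]_x (potential (EFin \o G N) x `^ P) <=
    (potential_Lp_cst P)%:E * \int[mu]_y (H y `^ P)%:E.
  apply: le_trans (potential_Lp_truncated (eps := N.+1%:R^-1) P1 _ (mG N) (G0 N) _ _) _.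
  - by rewrite invr_gt0 ltr0n.
  - move=> y dy; rewrite /G indicE memNset ?mulr0// => -[] /=.
    by rewrite leNgt dy.
  - apply: (@le_lt_trans _ _ (\int[mu]_y (N.+1%:R%:E * (\1_(Z N) y)%:E))).
      apply: ge0_le_integral => //.
      - by move=> y _; exact: EG0.
      - exact: mEG.
      - by apply: measurable_funeM; apply/measurable_EFinP; exact: measurable_indic.
      move=> y _; rewrite lee_fin ler_wpM2r// ge_min lexx orbT//.
    rewrite ge0_integralZl//; last first.
      by apply/measurable_EFinP; exact: measurable_indic.
    rewrite integral_indic// setIT.
    have ZA : mu (Z N) <= (A * N.+1%:R `^ b)%:E.
      apply: le_trans (mu_ball point (ltr0Sn _ N)).
      apply: le_measure; rewrite ?inE//; last by move=> y [].
      by rewrite -[X in measurable X]setTI; exact: measurable_fun_le.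
    apply: (@le_lt_trans _ _ (N.+1%:R%:E * (A * N.+1%:R `^ b)%:E)).
      by rewrite lee_wpmul2l// lee_fin.
    by rewrite -EFinM ltry.
  rewrite lee_wpmul2l ?lee_fin ?potential_Lp_cst_ge0//.
  apply: ge0_le_integral => //.
  - by move=> y _; rewrite lee_fin powR_ge0.
  - apply/measurable_EFinP; exact: (measurableT_comp (measurable_powR _) (mG N)).
  - apply/measurable_EFinP; exact: (measurableT_comp (measurable_powR _) mH).
  - by move=> y _; rewrite lee_fin powR_le// ltW.
have mp N : measurable_fun setT (fun x => potential (EFin \o G N) x `^ P).
  apply: (measurableT_comp (measurable_poweR _)).
  by apply: measurable_potential.
have pnd x : nondecreasing_seq (fun N => potential (EFin \o G N) x `^ P).
  by move=> N M NM; apply: poweR_le (potnd x _ _ NM); [exact: ltW|exact: potential_ge0].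
apply: (@le_trans _ _ (\int[mu]_x limn (fun N => potential (EFin \o G N) x `^ P))).
  apply: ge0_le_integral => //.
  - by move=> x _; exact: poweR_ge0.
  - apply: (measurableT_comp (measurable_poweR _)); apply: measurable_potential => //.
    exact/measurable_EFinP.
  - apply: (emeasurable_fun_cvg (fun N x => potential (EFin \o G N) x `^ P)) => //.
    by move=> x _; apply: ereal_nondecreasing_is_cvgn; exact: pnd.
  move=> x _; set L := limn _.
  have Lge N : potential (EFin \o G N) x `^ P <= L.
    have -> : L = ereal_sup (range (fun N => potential (EFin \o G N) x `^ P)).
      by apply/cvg_lim => //; apply: ereal_nondecreasing_cvgn; exact: pnd.
    by apply: ereal_sup_ubound; exists N.
  have L0 : 0 <= L by apply: le_trans (Lge 0%N); exact: poweR_ge0.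
  have pL : potential (EFin \o H) x <= L `^ P^-1.
    rewrite -lim_pot; apply: lime_le.
      by apply: ereal_nondecreasing_is_cvgn; exact: potnd.
    apply: nearW => N.
    have := poweR_le (r := P^-1) _ _ (Lge N).
    rewrite -poweRrM mulfV ?gt_eqF// poweRe1 ?potential_ge0//.
    by apply; [rewrite invr_ge0 ltW|exact: poweR_ge0].
  apply: (le_trans (poweR_le (ltW P0) _ pL)); first exact: potential_ge0.
  by rewrite -poweRrM mulVf ?gt_eqF// poweRe1.
rewrite (monotone_convergence mu measurableT) //.
- apply: lime_le; last exact: nearW.
  apply: ereal_nondecreasing_is_cvgn => N M NM; apply: ge0_le_integral => //.
  + by move=> x _; exact: poweR_ge0.
  + by move=> x _; exact: pnd.
- by move=> N x _; exact: poweR_ge0.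
Qed.

(** * Conical means *)

(** The points [y] with [bgauge x y <= 3 * t] include a ball of radius [t] around [x] as
soon as that ball meets the set from which [delta] is the distance. *)
Definition cone_mean (H : T -> \bar R) (x : T) (t : R) : \bar R :=
  \int[mu]_y ((t `^ (- (b + alpha)) * \1_[set y | (bgauge x y <= 3 * t)%R] y
               * delta y `^ alpha)%:E * H y).

Section cone_mean.
Variables (H : T -> \bar R) (x : T).
Hypotheses (mH : measurable_fun [set: T] H) (H0 : forall y, 0 <= H y).

Let beta_gt0 : (0 < b + alpha)%R. Proof. by rewrite ltr_wpDl. Qed.

Let ck (t : R) (y : T) : R :=
  (t `^ (- (b + alpha)) * \1_[set y | (bgauge x y <= 3 * t)%R] y * delta y `^ alpha)%R.

Let ck_ge0 t y : (0 <= ck t y)%R.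
Proof. by rewrite !mulr_ge0 ?powR_ge0. Qed.

Let mck : measurable_fun [set: measurableTypeR R * T] (fun z => ck z.1 z.2).
Proof.
apply: measurable_funM; last first.
  apply: (measurableT_comp (measurable_powR alpha)).
  exact: (measurableT_comp mdelta measurable_snd).
apply: measurable_funM.
  exact: (measurableT_comp (measurable_powR _) measurable_fst).
pose W : set (measurableTypeR R * T) := [set z | (bgauge x z.2 <= 3 * z.1)%R].
have mW : measurable W.
  rewrite -[W]setTI; apply: (measurable_fun_le (D := setT)) => //.
    exact: (measurableT_comp (mbgauger x) measurable_snd).
  by apply: measurable_funM => //; exact: measurable_fst.
have -> : (fun z : measurableTypeR R * T =>
    \1_[set y | (bgauge x y <= 3 * z.1)%R] z.2) = (\1_W : _ -> R).
  by apply/funext => z; rewrite !indicE; congr (_%:R); apply/idP/idP; rewrite !inE.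
exact: measurable_indic.
Qed.

Let mckH : measurable_fun [set: measurableTypeR R * T] (fun z => (ck z.1 z.2)%:E * H z.2).
Proof.
apply: emeasurable_funM; first exact/measurable_EFinP.
exact: (measurableT_comp mH measurable_snd).
Qed.

Let ckH_ge0 t y : 0 <= (ck t y)%:E * H y.
Proof. by rewrite mule_ge0// lee_fin. Qed.

Lemma measurable_cone_integrand t : measurable_fun [set: T] (fun y =>
  (t `^ (- (b + alpha)) * \1_[set y | (bgauge x y <= 3 * t)%R] y
    * delta y `^ alpha)%:E * H y).
Proof. exact: (measurableT_comp mckH (pair1_measurable t)). Qed.

Lemma cone_mean_ge0 t : 0 <= cone_mean H x t.
Proof. by apply: integral_ge0 => y _; exact: ckH_ge0. Qed.

Lemma measurable_cone_mean : measurable_fun [set: measurableTypeR R] (cone_mean H x).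
Proof.
exact: (measurable_fun_fubini_tonelli_F (m2 := mu) _ mckH).
Qed.

Lemma cone_mean_le_potential t : (0 < t)%R -> cone_mean H x t <= (3 `^ (b + alpha))%:E * potential H x.
Proof.
move=> t0; rewrite -ge0_integralZl//; last 2 first.
- exact: emeasurable_funM.
- by move=> y _; rewrite mule_ge0// lee_fin.
apply: ge0_le_integral => //.
- by move=> y _; exact: ckH_ge0.
- exact: (measurableT_comp mckH (pair1_measurable t)).
- by apply: measurable_funeM; exact: emeasurable_funM.
move=> y _; rewrite muleA lee_wpmul2r// -EFinM lee_fin.
have [dy|dy] := eqVneq (delta y) 0%R.
  by rewrite bkernel0// dy powR0 ?gt_eqF// !mulr0.
have dy0 : (0 < delta y)%R by rewrite lt_neqAle eq_sym dy delta_ge0.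
have r0 : (0 < bgauge x y)%R by rewrite (lt_le_trans dy0).
rewrite indicE; case: (boolP (y \in _)) => [|_]; last first.
  by rewrite mulr0 mul0r mulr_ge0 ?powR_ge0.
rewrite inE/= mulr1 => rt.
rewrite /bkernel mulrCA mulrC ler_wpM2l ?powR_ge0//.
apply: (@le_trans _ _ (3 `^ (b + alpha) * (3 * t) `^ (- (b + alpha)))%R).
  rewrite (powRM _ _ (ltW t0))// mulrA -powRD; last by rewrite pnatr_eq0 implybT.
  by rewrite subrr powRr0 mul1r.
by rewrite ler_wpM2l ?powR_ge0// powR_leN// ltW.
Qed.

(** The factor [4] replaces [t] by [bgauge x y + t <= 4 * t], to which
[integral_power_tail] applies. *)
Definition cone_cst := (4 `^ (1 + (b + alpha)) * (2 / (1 - 2 `^ (- (b + alpha)))))%R.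

Lemma cone_cst_ge0 : (0 <= cone_cst)%R.
Proof.
rewrite mulr_ge0 ?powR_ge0// divr_ge0// subr_ge0.
by rewrite powRN invf_le1 ?powR_gt0// -[leLHS](powRr0 2) ler_powR ?ler1n// ltW.
Qed.

(** Tonelli: for fixed [y] the integral over the scales [t >= bgauge x y / 3] of
[t^(-1-b-alpha)] is at most a multiple of [(bgauge x y)^(-b-alpha)]. *)
Lemma integral_cone_mean :
  \int[lebesgue_measure]_(t in `]0%R, 1%R[) (cone_mean H x t * (t^-1)%:E) <=
    cone_cst%:E * potential H x.
Proof.
pose h (z : measurableTypeR R * T) : \bar R :=
  (\1_(`]0%R, 1%R[ : set R) z.1 * z.1^-1)%:E * ((ck z.1 z.2)%:E * H z.2).
have h0 z : 0 <= h z.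
  rewrite mule_ge0 ?ckH_ge0// lee_fin indicE; case: (boolP (_ \in _)); last by rewrite mul0r.
  by rewrite inE/= in_itv/= mul1r invr_ge0 => /andP[/ltW].
have minv : measurable_fun [set: measurableTypeR R]
    (fun t => \1_(`]0%R, 1%R[ : set R) t * t^-1)%R.
  rewrite (_ : (fun t => _) = (fun t => \1_(`]0%R, 1%R[ : set R) t * t `^ (-1)))%R.
    by apply: measurable_funM; [exact: measurable_indic|exact: measurable_powR].
  apply/funext => t; rewrite indicE; case: (boolP (_ \in _)); last by rewrite !mul0r.
  by rewrite inE/= in_itv/= => /andP[t0 _]; rewrite powR_inv1 ?ltW.
have mh : measurable_fun setT h.
  apply: emeasurable_funM => //; apply/measurable_EFinP.
  exact: (measurableT_comp minv measurable_fst).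
have -> : \int[lebesgue_measure]_(t in `]0%R, 1%R[) (cone_mean H x t * (t^-1)%:E) =
    \int[lebesgue_measure]_t \int[mu]_y h (t, y).
  rewrite integral_mkcond; apply: eq_integral => t _; rewrite /h/= patchE.
  rewrite ge0_integralZl//; last 2 first.
  - exact: (measurableT_comp mckH (pair1_measurable t)).
  - rewrite lee_fin indicE; case: (boolP (_ \in _)); last by rewrite mul0r.
    by rewrite inE/= in_itv/= mul1r invr_ge0 => /andP[/ltW].
  by rewrite indicE; case: ifPn => _; [rewrite mul1r muleC|rewrite mul0r mul0e].
rewrite (fubini_tonelli (m1 := lebesgue_measure) (m2 := mu) h)//.
rewrite -ge0_integralZl//; last 3 first.
- exact: emeasurable_funM.
- by move=> y _; rewrite mule_ge0// lee_fin.
- by rewrite lee_fin cone_cst_ge0.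
apply: ge0_le_integral => //.
- by move=> y _; apply: integral_ge0.
- exact: (measurable_fun_fubini_tonelli_G (m1 := lebesgue_measure) h).
- by apply: measurable_funeM; exact: emeasurable_funM.
move=> y _; rewrite /h/=.
under eq_integral do rewrite muleA.
rewrite ge0_integralZr//; last 2 first.
- apply/measurable_EFinP; apply: measurable_funM => //.
  exact: (measurableT_comp mck (pair2_measurable y)).
- move=> t _; rewrite -EFinM lee_fin mulr_ge0// indicE.
  case: (boolP (_ \in _)); last by rewrite mul0r.
  by rewrite inE/= in_itv/= mul1r invr_ge0 => /andP[/ltW].
rewrite muleA lee_wpmul2r//.
have [dy|dy] := eqVneq (delta y) 0%R.
  rewrite bkernel0// mule0 integral0_eq// => t _; rewrite /ck dy powR0 ?gt_eqF//.
  by rewrite !mulr0 mule0.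
have dy0 : (0 < delta y)%R by rewrite lt_neqAle eq_sym dy delta_ge0.
have r0 : (0 < bgauge x y)%R by rewrite (lt_le_trans dy0).
have leb01 (r : R) : (0 < r)%R ->
    lebesgue_measure ((`]0%R, 1%R[ : set (measurableTypeR R)) `&` [set t : R | (t <= r)%R])
      <= (1 * r `^ 1)%:E.
  move=> r_gt0; rewrite powRr1 ?(ltW r_gt0)// mul1r.
  apply: (@le_trans _ _ (lebesgue_measure (`[0%R, r]%classic : set (measurableTypeR R)))).
    apply: le_measure; rewrite ?inE//.
    - by apply: measurableI => //; rewrite (_ : [set t | _] = `]-oo, r]%classic).
    - by move=> t [/=]; rewrite !in_itv/= => /andP[/ltW -> _] ->.
  by rewrite lebesgue_measure_itv/= lte_fin r_gt0 oppr0 adde0.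
have := @integral_power_tail _ (measurableTypeR R) R lebesgue_measure `]0%R, 1%R[%classic
   (measurable_itv _) id 1 1 _ _ leb01 (bgauge x y) (1 + (b + alpha)) ler01 _ r0.
rewrite ltrDl (_ : 1 - (1 + (b + alpha)) = - (b + alpha))%R; last by ring.
move=> sh.
apply: (@le_trans _ _ (\int[lebesgue_measure]_(t in `]0%R, 1%R[)
    ((4 `^ (1 + (b + alpha)) * delta y `^ alpha)%:E *
      ((bgauge x y + t) `^ (- (1 + (b + alpha))))%:E))).
  rewrite [leRHS]integral_mkcond; apply: ge0_le_integral => //.
  - move=> t _; rewrite -EFinM lee_fin mulr_ge0// indicE.
    case: (boolP (_ \in _)); last by rewrite mul0r.
    by rewrite inE/= in_itv/= mul1r invr_ge0 => /andP[/ltW].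
  - apply/measurable_EFinP; apply: measurable_funM => //.
    exact: (measurableT_comp mck (pair2_measurable y)).
  - apply/(measurable_restrictT _ (measurable_itv _)); apply: measurable_funTS.
    apply: measurable_funeM; apply/measurable_EFinP.
    apply: (measurableT_comp (measurable_powR _)).
    by apply: measurable_funD.
  move=> t _; rewrite patchE indicE; case: ifPn => [|_]; last by rewrite mul0r mul0e.
  rewrite inE/= in_itv/= mul1r => /andP[t0 t1].
  rewrite -!EFinM lee_fin /ck indicE; case: (boolP (y \in _)) => [|_]; last first.
    by rewrite mulr0 mul0r mulr0 !mulr_ge0 ?powR_ge0.
  rewrite inE/= mulr1 => rt.
  rewrite mulrA [leRHS]mulrAC ler_wpM2r ?powR_ge0//.
  rewrite -(powR_inv1 (ltW t0)) -powRD; last by rewrite (gt_eqF t0) implybT.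
  rewrite -opprD.
  apply: (@le_trans _ _ (4 `^ (1 + (b + alpha)) * (4 * t) `^ (- (1 + (b + alpha))))%R).
    rewrite (powRM _ _ (ltW t0))// mulrA -powRD; last by rewrite pnatr_eq0 implybT.
    by rewrite subrr powRr0 mul1r.
  rewrite ler_wpM2l ?powR_ge0// powR_leN//.
  - by rewrite addr_ge0// ltW.
  - by rewrite addr_gt0.
  - lra.
rewrite ge0_integralZl//; last 3 first.
- apply/measurable_EFinP; apply: (measurableT_comp (measurable_powR _)).
  by apply: measurable_funTS; apply: measurable_funD.
- by move=> t _; rewrite lee_fin powR_ge0.
- by rewrite lee_fin mulr_ge0 ?powR_ge0.
apply: le_trans (lee_wpmul2l _ (sh _ _ _)) _ => //.
- by rewrite lee_fin mulr_ge0 ?powR_ge0.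
- by move=> t /=; rewrite in_itv/= => /andP[/ltW].
rewrite -!EFinM lee_fin /cone_cst /bkernel powRr1// mul1r.
by rewrite le_eqVlt; apply/orP; left; apply/eqP; ring.
Qed.

(** All but one of the [r] factors are bounded by [cone_mean_le_potential], and the last
one is integrated by [integral_cone_mean].  The summand [1] makes the constant positive,
for the case of an infinite potential. *)
Lemma integral_cone_mean_powR r : (1 <= r)%R ->
  \int[lebesgue_measure]_(t in `]0%R, 1%R[) (cone_mean H x t `^ r * (t^-1)%:E) <=
    ((3 `^ (b + alpha)) `^ (r - 1) * (cone_cst + 1))%:E * potential H x `^ r.
Proof.
move=> r1; have r0 : (0 < r)%R by rewrite (lt_le_trans ltr01).
have p0 : 0 <= potential H x by exact: potential_ge0.
have [poo|poo] := eqVneq (potential H x) +oo.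
  rewrite poo poweRyr ?gt_eqF// gt0_muley ?leey// lte_fin mulr_gt0 ?powR_gt0//.
  by rewrite ltr_wpDl// cone_cst_ge0.
have pfin : potential H x \is a fin_num by rewrite ge0_fin_numE// ltey.
have mt : measurable_fun (`]0%R, 1%R[%classic : set (measurableTypeR R)) (fun t : measurableTypeR R => (t^-1)%:E).
  apply/measurable_EFinP.
  apply: (eq_measurable_fun ((@powR R) ^~ (-1)%R)); last first.
    by apply: measurable_funTS; exact: measurable_powR.
  by move=> t; rewrite inE/= in_itv/= => /andP[t0 _]; rewrite powR_inv1 ?ltW.
have mc : measurable_fun (`]0%R, 1%R[%classic : set (measurableTypeR R)) (cone_mean H x).
  by apply: measurable_funTS; exact: measurable_cone_mean.
have t0 (t : R) : t \in (`]0%R, 1%R[ : interval R) -> (0 < t)%R by rewrite in_itv/= => /andP[].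
pose M := (3 `^ (b + alpha))%:E * potential H x.
apply: (@le_trans _ _ (\int[lebesgue_measure]_(t in `]0%R, 1%R[)
   (M `^ (r - 1) * (cone_mean H x t * (t^-1)%:E)))).
  apply: ge0_le_integral => //.
  - by move=> t /= /t0 tp; rewrite mule_ge0 ?poweR_ge0// lee_fin invr_ge0 ltW.
  - apply: emeasurable_funM => //.
    exact: (measurableT_comp (measurable_poweR _) mc).
  - by apply: measurable_funeM; exact: emeasurable_funM.
  move=> t /= /t0 tp; rewrite muleA lee_wpmul2r ?lee_fin ?invr_ge0 ?(ltW tp)//.
  have cM : cone_mean H x t <= M by exact: cone_mean_le_potential.
  have cfin : cone_mean H x t \is a fin_num.
    rewrite ge0_fin_numE ?cone_mean_ge0// (le_lt_trans cM)//.
    by rewrite /M -(fineK pfin) -EFinM ltry.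
  apply: (@le_trans _ _ (cone_mean H x t `^ (r - 1) * cone_mean H x t)).
    rewrite -(fineK cfin) !poweR_EFin -EFinM mulrC mulr_powRB1//.
    by rewrite fine_ge0 ?cone_mean_ge0.
  by rewrite lee_wpmul2r ?cone_mean_ge0// poweR_le ?subr_ge0 ?cone_mean_ge0.
rewrite ge0_integralZl//; last 3 first.
- exact: emeasurable_funM.
- by move=> t /= /t0 tp; rewrite mule_ge0 ?cone_mean_ge0// lee_fin invr_ge0 ltW.
- exact: poweR_ge0.
apply: (@le_trans _ _ (M `^ (r - 1) * (cone_cst%:E * potential H x))).
  by rewrite lee_wpmul2l ?poweR_ge0// integral_cone_mean.
move: p0 pfin; rewrite /M; case: (potential H x) => // v; rewrite lee_fin => f0 _.
rewrite poweRM; [|by rewrite lee_fin powR_ge0|by rewrite lee_fin].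
rewrite !poweR_EFin -!EFinM lee_fin; move: cone_cst cone_cst_ge0 => cc cc0.
rewrite -(mulr_powRB1 f0 r0).
rewrite -!mulrA ler_wpM2l ?powR_ge0// mulrCA ler_pM ?mulr_ge0 ?powR_ge0//.
  by rewrite lerDl.
by rewrite mulrC.
Qed.

End cone_mean.
End kernel.

(** * Measurability of the local approximation error *)

Section integrals_on_sets.
Local Open Scope ereal_scope.
Context d (T : measurableType d) (R : realType) (mu : {measure set T -> \bar R}).

Lemma integral_powR_subr_lty (B : set T) (f h : T -> R) (M u : R) :
  measurable B -> measurable_fun [set: T] f -> measurable_fun [set: T] h ->
  (0 < u)%R -> (0 <= M)%R -> (forall y, B y -> `|h y| <= M)%R -> mu B < +oo ->
  \int[mu]_(y in B) (`|f y| `^ u)%:E < +oo ->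
  \int[mu]_(y in B) (`|f y - h y| `^ u)%:E < +oo.
Proof.
move=> mB mf mh u0 M0 hM muB intf.
have mpow (g : T -> R) : measurable_fun [set: T] g ->
    measurable_fun B (fun y => (`|g y| `^ u)%:E).
  move=> mg; apply: measurable_funTS; apply/measurable_EFinP.
  by apply: (measurableT_comp (measurable_powR _)); exact: measurableT_comp.
apply: (@le_lt_trans _ _ (\int[mu]_(y in B)
   ((2 `^ u)%:E * ((`|f y| `^ u)%:E + (M `^ u)%:E)))).
  apply: ge0_le_integral => //.
  - by apply: (mpow (fun y => f y - h y)%R); exact: measurable_funB.
  - by apply: measurable_funeM; apply: emeasurable_funD => //; exact: mpow.
  move=> y By; rewrite -EFinD -EFinM lee_fin.
  apply: le_trans (powR_add_le (normr_ge0 _) M0 (ltW u0)).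
  by rewrite powR_le ?(ltW u0)// (le_trans (ler_normB _ _))// lerD2l hM.
rewrite ge0_integralZl//; last 2 first.
- by apply: emeasurable_funD => //; exact: mpow.
- by move=> y _; rewrite -EFinD lee_fin addr_ge0 ?powR_ge0.
rewrite ge0_integralD//; last 2 first.
- exact: mpow.
- by move=> y _; rewrite lee_fin powR_ge0.
rewrite integral_cst//.
by rewrite lte_mul_pinfty ?lee_fin ?powR_ge0// lte_add_pinfty// lte_mul_pinfty ?lee_fin ?powR_ge0.
Qed.

(** Dominated convergence; pointwise eventual equality with the limit set replaces
monotonicity of the sets. *)
Lemma integral_bigcap_lt (g : T -> R) (C : nat -> set T) (B : set T) (c : \bar R) :
  measurable_fun [set: T] g -> (forall y, 0 <= g y)%R ->
  (forall m, measurable (C m)) -> measurable B ->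
  (forall m, C m `<=` C 0%N) -> B `<=` C 0%N ->
  (forall y, \forall m \near \oo, C m y = B y) ->
  \int[mu]_(y in C 0%N) (g y)%:E < +oo -> \int[mu]_(y in B) (g y)%:E < c ->
  exists m, \int[mu]_(y in C m) (g y)%:E < c.
Proof.
move=> mg g0 mC mB C0 B0 CB ioo Bc; set D := C 0%N in C0 B0 ioo *.
have ig : mu.-integrable D (EFin \o g).
  apply/integrableP; split; first by apply: measurable_funTS; exact/measurable_EFinP.
  by under eq_integral do rewrite gee0_abs ?lee_fin//.
pose f_ m y := (g y * \1_(C m) y)%:E.
pose f y := (g y * \1_B y)%:E.
have CE (A : set T) : measurable A -> A `<=` D ->
    \int[mu]_(y in D) (g y * \1_A y)%:E = \int[mu]_(y in A) (g y)%:E.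
  move=> mA AD; rewrite integral_mkcond [RHS]integral_mkcond; apply: eq_integral => y _.
  rewrite !patchE indicE; case: (boolP (y \in A)) => yA; last by rewrite mulr0; case: ifP.
  by rewrite mulr1 mem_set//; apply: AD; rewrite inE in yA.
have cvgP : \int[mu]_(y in D) f_ m y @[m --> \oo] --> \int[mu]_(y in D) f y.
  apply: (@dominated_cvg _ _ _ mu D (mC 0%N) f_ f (EFin \o g)) => //.
  - move=> m; apply: measurable_funTS; apply/measurable_EFinP.
    by apply: measurable_funM => //; exact: measurable_indic.
  - move=> y _; apply: cvg_near_cst; have [m _ Cm] := CB y; exists m => // k /Cm Ck.
    by rewrite /f_ /f !indicE; do 2 f_equal; rewrite /in_mem/= /mem_set; congr (nat_of_bool _)%:R; apply/idP/idP; rewrite !inE/= Ck.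
  - move=> m y _; rewrite /f_ gee0_abs; last by rewrite lee_fin mulr_ge0.
    by rewrite lee_fin indicE; case: (_ \in _); rewrite ?mulr1// mulr0.
have fc : \int[mu]_(y in D) f y < c by rewrite CE.
have /= := cvgP _ (open_ereal_lt' fc).
by move=> [m _ /(_ m (leqnn m))] /=; rewrite CE// => mc; exists m.
Qed.

End integrals_on_sets.

Section measurability.
Context (R : realType) (n : nat).
Local Open Scope ereal_scope.
Local Notation lambda := (@lebesgue_measure_rV R n).
Local Notation V := (lebesgue_rV R n).

Lemma measurable_mpoly_eval (P : mpoly n R) :
  measurable_fun [set: V] (mpoly_eval P : V -> R).
Proof.
rewrite /mpoly_eval; under eq_fun do rewrite mevalE.
apply: measurable_sum => m; apply: measurable_funM; first exact: measurable_cst.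
elim: (index_enum _) => [|i s IH].
  by under eq_fun do rewrite big_nil; exact: measurable_cst.
under eq_fun do rewrite big_cons.
exact: (measurable_funM (measurable_funX _ (measurable_coord i)) IH).
Qed.

Lemma mpoly_eval_bounded (P : mpoly n R) (r : R) : (0 <= r)%R ->
  exists2 M : R, (0 <= M)%R & forall y : 'rV[R]_n, (`|y| <= r)%R -> (`|mpoly_eval P y| <= M)%R.
Proof.
move=> r0.
exists (\sum_(m <- msupp P) `|mcoeff m P| * \prod_(i < n) r ^+ m i)%R.
  by apply: sumr_ge0 => m _; rewrite mulr_ge0// prodr_ge0// => i _; rewrite exprn_ge0.
move=> y /(rV_normP _ r0) yr; rewrite /mpoly_eval mevalE.
apply: (le_trans (ler_norm_sum _ _ _)); apply: ler_sum => m _.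
rewrite normrM ler_wpM2l// normr_prod; apply: ler_prod => i _.
by rewrite normr_ge0 normrX lerXn2r ?nnegrE//.
Qed.

Section local.
Variables (F : 'rV[R]_n -> R) (u : R).
Hypotheses (u0 : (0 < u)%R) (mF : measurable_fun [set: V] (F : V -> R)).
Hypothesis locF : forall r, \int[lambda]_(y in (cube 0%R r : set V)) (`|F y| `^ u)%:E < +oo.

Let g (P : mpoly n R) (y : V) : R := (`|F y - mpoly_eval P y| `^ u)%R.

Let mg P : measurable_fun [set: V] (g P).
Proof.
apply: (measurableT_comp (measurable_powR _)).
exact: (measurableT_comp (@normr_measurable R setT)
  (measurable_funB mF (measurable_mpoly_eval P))).
Qed.

Let g0 P y : (0 <= g P y)%R. Proof. exact: powR_ge0. Qed.

Let error P x t := \int[lambda]_(y in (cube x t : set V)) (g P y)%:E.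

Lemma cube_sub (x x' : 'rV[R]_n) (t t' : R) : (`|x - x'| + t <= t')%R ->
  cube x t `<=` cube x' t'.
Proof.
move=> xt y; rewrite /cube/= => xy; apply: le_trans xt.
rewrite (le_trans (ler_distD x _ _))// [X in (X + _)%R]distrC lerD2l//.
Qed.

Lemma norm_cube (x y : 'rV[R]_n) (t : R) : cube x t y -> (`|y| <= `|x| + t)%R.
Proof.
move=> xy; rewrite -[X in (Num.norm X <= _)%R](subKr x).
by rewrite (le_trans (ler_normB _ _))// lerD2l.
Qed.

Lemma local_error_finite P x t : error P x t < +oo.
Proof.
have [t0|t0] := leP 0%R t; last first.
  rewrite /error (_ : cube x t = set0) ?integral_set0//.
  by apply/seteqP; split=> y //=; rewrite /cube/= leNgt (lt_le_trans t0).
pose r := (`|x| + t)%R.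
have r0 : (0 <= r)%R by rewrite addr_ge0.
have [M M0 PM] := mpoly_eval_bounded P r0.
apply: integral_powR_subr_lty (measurable_cube _ _) mF (measurable_mpoly_eval P) u0 M0 _ _ _.
- move=> y xy; apply: PM.
  exact: (norm_cube xy).
- by rewrite [X in X < _](lebesgue_cube x t0) ltry.
apply: le_lt_trans (locF r); apply: ge0_subset_integral.
- exact: measurable_cube.
- exact: measurable_cube.
- apply: measurable_funTS; apply/measurable_EFinP.
  by apply: (measurableT_comp (measurable_powR u)); exact: (measurableT_comp (@normr_measurable _ _) mF).
- by move=> y _; rewrite lee_fin powR_ge0.
- by apply: cube_sub; rewrite subr0.
Qed.

(** Nearby cubes are contained in a slightly enlarged concentric cube, over which the
integral is still less than [c]. *)
Lemma local_error_usc P x t c : (0 < t)%R -> error P x t < c ->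
  exists2 r, (0 < r)%R & forall t' x', (`|t - t'| < r)%R -> (`|x - x'| < r)%R ->
    error P x' t' < c.
Proof.
move=> t0 Pc.
pose C m := cube x (t + m.+1%:R^-1) : set V.
have C0 m : C m `<=` C 0%N.
  apply: cube_sub; rewrite subrr normr0 add0r lerD2l invr1 invf_le1 ?ltr0n// ler1n//.
have tC : cube x t `<=` C 0%N by apply: cube_sub; rewrite subrr normr0 add0r lerDl.
have CB y : \forall m \near \oo, C m y = cube x t y.
  have [xy|xy] := leP `|x - y|%R t.
    apply: nearW => m; apply/propext; split=> // _.
    by apply: (le_trans xy); rewrite lerDl invr_ge0.
  exists (Num.truncn (`|x - y| - t)^-1)%R => // m /= mN.
  apply/propext; split=> [|/(lt_le_trans xy)]; last by rewrite ltxx.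
  rewrite /C /cube/= leNgt => /negP[]; rewrite -ltrBrDl.
  rewrite invf_plt ?posrE ?ltr0n ?subr_gt0//.
  by rewrite (lt_le_trans (truncnS_gt _))// ler_nat ltnS.
have [m mc] := integral_bigcap_lt (mg P) (g0 P) (fun m => measurable_cube x (t + m.+1%:R^-1))
  (measurable_cube x t) C0 tC CB (local_error_finite _ _ _) Pc.
exists (m.+1%:R^-1 / 2)%R; first by rewrite divr_gt0// invr_gt0 ltr0n.
move=> t' x' tt xx; apply: le_lt_trans mc.
apply: ge0_subset_integral.
- exact: measurable_cube.
- exact: measurable_cube.
- by apply: measurable_funTS; apply/measurable_EFinP; exact: mg.
- by move=> y _; rewrite lee_fin; exact: g0.
apply: cube_sub; rewrite distrC.
have : (t' <= t + m.+1%:R^-1 / 2)%R.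
  by rewrite -lerBlDl (le_trans (ler_norm _))// distrC ltW.
move=> te; rewrite (splitr m.+1%:R^-1)%R addrA.
by apply: le_trans (lerD (ltW xx) te) _; rewrite addrC.
Qed.

Lemma local_approx_ge0 k Q : 0 <= local_approx k u F Q.
Proof. by apply: le_ereal_inf_tmp => _ [P _ <-]; exact: poweR_ge0. Qed.

Let meanE P x t : (0 < t)%R ->
  ((lambda (cube x t))^-1 * error P x t) `^ u^-1 =
  ((((2 * t) ^+ n)^-1 * fine (error P x t)) `^ u^-1)%:E.
Proof.
move=> t0; rewrite [X in X^-1](lebesgue_cube x (ltW t0)).
have tn : ((2 * t) ^+ n)%R != 0%R by rewrite expf_neq0// mulf_neq0// gt_eqF.
rewrite -[X in (_ * X) `^ _]fineK; last first.
  by rewrite ge0_fin_numE ?local_error_finite//; apply: integral_ge0 => y _; rewrite lee_fin.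
by rewrite inver (negbTE tn) -EFinM poweR_EFin.
Qed.

(** An infimum over any family of upper semicontinuous functions is upper
semicontinuous; this yields measurability in spite of the uncountably many
polynomials. *)
Lemma local_approx_usc k (c : R) x t : (0 < t)%R ->
  local_approx k u F (cube x t) < c%:E ->
  exists2 r, (0 < r)%R & forall t' x', (0 < t')%R -> (`|t - t'| < r)%R ->
    (`|x - x'| < r)%R -> local_approx k u F (cube x' t') < c%:E.
Proof.
move=> t0 /ereal_inf_lt[_ [P Pk <-]].
have Phi0 x' t' : (0 <= fine (error P x' t'))%R.
  by rewrite fine_ge0//; apply: integral_ge0 => y _; rewrite lee_fin.
have PhiE x' t' : error P x' t' = (fine (error P x' t'))%:E.
  rewrite fineK// ge0_fin_numE ?local_error_finite//.
  by apply: integral_ge0 => y _; rewrite lee_fin.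
have tn (a : R) : (0 < a)%R -> (0 < (2 * a) ^+ n)%R by move=> a0; rewrite exprn_gt0// mulr_gt0.
rewrite -/(error P x t) meanE// lte_fin => Pc.
have c0 : (0 < c)%R by rewrite (le_lt_trans _ Pc)// powR_ge0.
move: Pc; rewrite powRV_lt//; last by rewrite mulr_ge0 ?invr_ge0 ?(ltW (tn _ _)).
rewrite ltr_pdivrMl ?tn// => Pc.
set v := fine _ in Pc.
pose b := ((v + (2 * t) ^+ n * c `^ u) / 2)%R.
have vb : (v < b)%R by rewrite /b; lra.
have bc : (b < (2 * t) ^+ n * c `^ u)%R by rewrite /b; lra.
have [r1 r10 Pr1] : exists2 r, (0 < r)%R & forall t' x', (`|t - t'| < r)%R ->
    (`|x - x'| < r)%R -> error P x' t' < b%:E.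
  by apply: local_error_usc => //; rewrite PhiE lte_fin.
have ct : {for t, continuous (fun a : R => (2 * a) ^+ n * c `^ u)%R}.
  move=> z; apply: cvgM; last exact: cvg_cst.
  apply: (@continuous_comp _ _ _ (fun a : R => 2 * a)%R (fun a => a ^+ n)%R).
    exact: mulrl_continuous.
  exact: exprn_continuous.
have near_t : nbhs t [set a : R | (b < (2 * a) ^+ n * c `^ u)%R].
  by apply: (cvgr_gt _ ct); exact: bc.
have /nbhs_ballP[r2 /= r20 Pr2] := near_t.
exists (Num.min r1 r2); first by rewrite lt_min r10.
move=> t' x' t'0; rewrite !lt_min => /andP[tt1 tt2] /andP[xx1 _].
apply: (@le_lt_trans _ _ (((lambda (cube x' t'))^-1 * error P x' t') `^ u^-1)).
  by apply: ereal_inf_lbound; exists P.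
rewrite meanE// lte_fin powRV_lt//; last by rewrite mulr_ge0 ?invr_ge0 ?(ltW (tn _ _)).
rewrite ltr_pdivrMl ?tn//; apply: lt_trans (Pr2 t' tt2).
by have := Pr1 t' x' tt1 xx1; rewrite PhiE lte_fin.
Qed.

Let I01 : set (measurableTypeR R) := `]0%R, 1%R[%classic.

Lemma measurable_local_approx k :
  measurable_fun (I01 `*` [set: V])
    (fun z : measurableTypeR R * V => local_approx k u F (cube z.2 z.1)).
Proof.
apply: (measurability (@ErealGenInftyO.G R)) => [|_ [_ [c ->] <-]].
  exact: ErealGenInftyO.measurableE.
apply: measurable_open_prod => t x [[/= + _]].
rewrite /I01 /= in_itv/= => /andP[t0 t1]; rewrite in_itv/= => tc.
have [r r0 rP] := local_approx_usc t0 tc.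
exists (Num.min r (Num.min t (1 - t))%R); first by rewrite !lt_min r0 t0 subr_gt0.
move=> t' x'; rewrite !lt_min => /andP[tr /andP[tt tt1]] /andP[xr _].
have t'0 : (0 < t')%R by move: tt; rewrite ltr_distlC; lra.
have t'1 : (t' < 1)%R by move: tt1; rewrite ltr_distlC; lra.
split; first by split=> //; rewrite /I01/= in_itv/= t'0.
by rewrite /= in_itv/=; exact: rP.
Qed.

Variables (k : nat) (s q : R).

Let h (z : measurableTypeR R * V) : \bar R :=
  ((z.1 `^ (- s))%:E * local_approx k u F (cube z.2 z.1)) `^ q * (z.1^-1)%:E.

Let mI01 : measurable (I01 `*` [set: V]).
Proof. by apply: measurableX => //; exact: measurable_itv. Qed.

Let mh : measurable_fun [set: measurableTypeR R * V] (h \_ (I01 `*` [set: V])).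
Proof.
apply/(measurable_restrictT _ mI01).
apply: emeasurable_funM.
  apply: (measurableT_comp (measurable_poweR q)).
  apply: emeasurable_funM; last exact: measurable_local_approx.
  apply/measurable_EFinP.
  exact: (measurable_funTS (measurableT_comp (measurable_powR _) measurable_fst)).
apply/measurable_EFinP.
apply: (eq_measurable_fun (fun z : measurableTypeR R * V => z.1 `^ (-1))%R).
  move=> z; rewrite inE => -[/= + _]; rewrite /I01/= in_itv/= => /andP[z0 _].
  by rewrite powR_inv1 ?ltW.
exact: (measurable_funTS (measurableT_comp (measurable_powR _) measurable_fst)).
Qed.

Let hE x t : (h \_ (I01 `*` [set: V])) (t, x) = ((fun t => h (t, x)) \_ I01) t.
Proof.
rewrite !patchE; congr (if _ then _ else _).
by apply/idP/idP; rewrite !inE => // -[].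
Qed.

Lemma measurable_TL_integrand (x : 'rV[R]_n) :
  measurable_fun I01 (fun t : measurableTypeR R =>
    ((t `^ (- s))%:E * local_approx k u F (cube x t)) `^ q * (t^-1)%:E).
Proof.
apply/(measurable_restrictT _ (measurable_itv _)).
have := measurableT_comp mh (pair2_measurable (x : V)).
by apply: eq_measurable_fun => t _ /=; rewrite hE.
Qed.

Lemma measurable_TL_fun : measurable_fun [set: V] (TL_fun k u s q F : V -> \bar R).
Proof.
apply: (measurableT_comp (measurable_poweR _)).
have h0 z : 0 <= (h \_ (I01 `*` [set: V])) z.
  rewrite patchE; case: ifPn => //; rewrite inE => -[/= + _].
  rewrite /I01/= in_itv/= => /andP[z0 _].
  by rewrite mule_ge0 ?poweR_ge0// lee_fin invr_ge0 ltW.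
have := measurable_fun_fubini_tonelli_G (m1 := lebesgue_measure) _ mh h0.
apply: eq_measurable_fun => x _; rewrite /fubini_G [RHS]integral_mkcond.
by apply: eq_integral => t _; rewrite hE.
Qed.

End local.
End measurability.

(** * Distance to the boundary *)

Section geometry.
Context (R : realType) (n : nat).
Local Notation lambda := (@lebesgue_measure_rV R n).
Local Notation V := (lebesgue_rV R n).
Local Open Scope ereal_scope.

(** The Lebesgue measure packaged as a sigma-finite measure, for Tonelli's theorem. *)
Definition lebesgue_sf : {sigma_finite_measure set V -> \bar R} :=
  HB.pack (measure_function.Measure.sort lambda) (measure_function.Measure.class lambda)
    (Measure_isSigmaFinite.Build _ V R lambda (@lebesgue_rV_sigma_finite R n)).

Lemma lebesgue_sfE (f : V -> \bar R) D : \int[lebesgue_sf]_(x in D) f x = \int[lambda]_(x in D) f x.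
Proof. by []. Qed.

Variable S : set 'rV[R]_n.
(** Real-valued, so equal to 0 everywhere when [S] is empty. *)
Definition bdist (y : 'rV[R]_n) : R := fine (edist_inf S y).

Lemma bdist_ge0 y : (0 <= bdist y)%R.
Proof. by rewrite fine_ge0// edist_inf_ge0. Qed.

Lemma edist_rV_le (x y : 'rV[R]_n) : edist (x, y) <= `|x - y|%:E.
Proof.
apply/lee_addgt0Pr => e e0; rewrite -EFinD; apply: edist_fin => /=.
  by rewrite ltr_wpDl.
by rewrite -ball_normE /ball_/= ltrDl.
Qed.

Lemma edist_inf_le (a y : 'rV[R]_n) : S a -> edist_inf S y <= `|y - a|%:E.
Proof.
move=> Sa; apply: le_trans (edist_rV_le y a).
by apply: ereal_inf_lbound; exists a.
Qed.

Lemma bdistE y : S !=set0 -> edist_inf S y = (bdist y)%:E.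
Proof.
move=> [a Sa]; rewrite fineK// ge0_fin_numE ?edist_inf_ge0//.
by rewrite (le_lt_trans (edist_inf_le y Sa))// ltry.
Qed.

Lemma bdist_le (a y : 'rV[R]_n) : S a -> (bdist y <= `|y - a|)%R.
Proof.
by move=> Sa; rewrite -lee_fin -bdistE; [exact: edist_inf_le|exists a].
Qed.

Lemma bdist_lip (x y : 'rV[R]_n) : S !=set0 -> (bdist x <= bdist y + `|x - y|)%R.
Proof.
move=> S0; rewrite -lee_fin EFinD -!bdistE// addeC.
by rewrite (le_trans (edist_inf_triangle S x y))// leeD2r// edist_rV_le.
Qed.

Lemma measurable_bdist : measurable_fun [set: V] (bdist : V -> R).
Proof.
have [S0|/set0P/negP/negPn/eqP S0] := pselect (S !=set0); last first.
  rewrite (_ : bdist = cst 0%R); first exact: measurable_cst.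
  by apply/funext => y; rewrite /bdist /edist_inf S0 image_set0 ereal_inf0.
apply: (measurability (@RGenInftyO.G R)) => [|_ [_ [c ->] <-]].
  exact: RGenInftyO.measurableE.
rewrite setTI; apply: measurable_open.
rewrite openE => x; rewrite /= in_itv/= => xc.
apply/nbhs_ballP; exists (c - bdist x)%R => /=; first by rewrite subr_gt0.
move=> y; rewrite -ball_normE /ball_/= => xy; rewrite in_itv/=.
rewrite (le_lt_trans (bdist_lip y x S0))// -ltrBrDl distrC//.
Qed.

End geometry.
Arguments lebesgue_sf {R n}.

Section domain.
Context (R : realType) (n : nat) (Omega : set 'rV[R]_n).
Hypothesis oO : open Omega.
Local Notation S := (boundary Omega).

Let OI : Omega = Omega^°. Proof. by apply/esym/interior_id. Qed.

Lemma bdist_gt0 y : S !=set0 -> Omega y -> 0 < bdist S y.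
Proof.
move=> S0 Oy; have /nbhs_ballP[r /= r0 rO] := open_nbhs_nbhs (conj oO Oy).
rewrite (lt_le_trans r0)// -lee_fin -bdistE//.
apply: le_ereal_inf_tmp => _ [a [_ Sa] <-].
rewrite leNgt; apply/negP => /edist_lt_ball/= ya; apply: Sa.
by rewrite -OI; exact: rO.
Qed.

(** Otherwise a segment in the cube joins a point of [Omega] to a point outside; the
parameters of its points in [Omega] form a set that is open in the unit interval, and
also closed in it, as the closure of [Omega] adds only points of [S]. *)
Lemma cube_sub_or_disjoint x t : cube x t `&` S = set0 ->
  cube x t `<=` Omega \/ cube x t `&` Omega = set0.
Proof.
move=> xS; have [|/set0P/negP/negPn/eqP] := pselect (cube x t `&` Omega !=set0); last by right.
move=> [a [xa Oa]]; left=> b xb.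
pose g (z : R) : 'rV[R]_n := a + z *: (b - a).
have cg : continuous g.
  by move=> z; apply: cvgD; [exact: cvg_cst|apply: cvgZr_tmp; exact: cvg_id].
have gcube z : z \in `[0, 1] -> cube x t (g z).
  rewrite in_itv/= => /andP[z0 z1]; rewrite /cube/= /g.
  have -> : x - (a + z *: (b - a)) = (1 - z) *: (x - a) + z *: (x - b).
    by apply/rowP => i; rewrite !mxE; ring.
  rewrite (le_trans (ler_normD _ _))// !normrZ (ger0_norm z0) ger0_norm ?subr_ge0//.
  have -> : t = (1 - z) * t + z * t by ring.
  by rewrite lerD// ler_wpM2l// subr_ge0.
have clO z : z \in `[0, 1] -> closure Omega (g z) -> Omega (g z).
  move=> z01 cz; apply: contrapT => nz.
  suff : (cube x t `&` S) (g z) by rewrite xS.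
  by split; [exact: gcube|split=> //; rewrite -OI].
pose B := [set z | z \in `[0, 1] /\ Omega (g z)].
suff BE : B = `[0, 1]%classic.
  have : B 1 by rewrite BE/= in_itv/= ler01 lexx.
  by rewrite /B/= /g scale1r subrKC => -[].
apply: segment_connected.
- by exists 0; split; [rewrite in_itv/= lexx ler01|rewrite /g scale0r addr0].
- exists (g @^-1` Omega); first by apply: open_comp => // z _; exact: cg.
  by apply/seteqP; split=> z.
- exists (g @^-1` closure Omega).
    by apply: preimage_closed => [z _|]; [exact: cg|exact: closed_closure].
  apply/seteqP; split=> z [z01 gz]; split=> //; first exact: subset_closure.
  exact: clO.
Qed.

End domain.

(** * Bounds on L^p norms *)

Lemma Lnorm_EFinE d (T : measurableType d) (R : realType) (mu : {measure set T -> \bar R})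
    (p : R) (f : T -> R) :
  'N[mu]_p%:E[EFin \o f]%E = ((\int[mu]_x (`|f x| `^ p)%:E) `^ p^-1)%E.
Proof. by rewrite unlock. Qed.

Lemma Lnorm_ge0E d (T : measurableType d) (R : realType) (mu : {measure set T -> \bar R})
    (p : R) (f : T -> \bar R) : (forall x, (0 <= f x)%E) ->
  'N[mu]_p%:E[f]%E = ((\int[mu]_x (f x `^ p)) `^ p^-1)%E.
Proof.
move=> f0; rewrite unlock; apply: (congr1 (fun z => z `^ p^-1)%E).
by apply: eq_integral => x _; rewrite gee0_abs.
Qed.

Section Lp_bounds.
Local Open Scope ereal_scope.
Context d (T : measurableType d) (R : realType) (mu : {measure set T -> \bar R}).

Lemma integral_powR_lty (B : set T) (f : T -> R) (u p : R) :
  measurable B -> measurable_fun [set: T] f -> (0 < u <= p)%R -> mu B < +oo ->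
  \int[mu]_y (`|f y| `^ p)%:E < +oo ->
  \int[mu]_(y in B) (`|f y| `^ u)%:E < +oo.
Proof.
move=> mB mf /andP[u0 up] muB intf.
have mpow (r : R) : measurable_fun [set: T] (fun y => (`|f y| `^ r)%:E).
  apply/measurable_EFinP.
  by apply: (measurableT_comp (measurable_powR _)); exact: measurableT_comp.
apply: (@le_lt_trans _ _ (\int[mu]_(y in B) (1 + (`|f y| `^ p)%:E))).
  apply: ge0_le_integral => //.
  - exact: measurable_funTS.
  - by apply: emeasurable_funD => //; exact: measurable_funTS.
  move=> y _; rewrite -EFinD lee_fin; have [f1|f1] := leP `|f y|%R 1%R.
    by rewrite ler_wpDr ?powR_ge0// -[leRHS](congr1 (@^~ u) (powR1 R)) powR_le// ltW.
  by rewrite ler_wpDl// ler_powR// ltW.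
rewrite ge0_integralD//; last exact: measurable_funTS.
rewrite integral_cst// mul1e lte_add_pinfty//.
apply: le_lt_trans intf; apply: ge0_subset_integral => //.
Qed.

(** Sums are split by [poweR_add_le], first with the exponent [p] and then with [p^-1];
this is where the powers of 2 come from. *)
Lemma Lp_bound_of_pointwise (G g h : T -> \bar R) (W : \bar R) (p u c c' K : R) :
  measurable_fun [set: T] G -> measurable_fun [set: T] g -> measurable_fun [set: T] h ->
  (forall x, 0 <= G x) -> (forall x, 0 <= g x) -> (forall x, 0 <= h x) -> 0 <= W ->
  (0 < p)%R -> (0 <= c)%R -> (0 <= c')%R -> (0 <= K)%R ->
  (forall x, G x <= c%:E * (g x + c'%:E * h x `^ u^-1)) ->
  \int[mu]_x (h x `^ (p / u)) <= K%:E * W ->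
  'N[mu]_p%:E[G] <= ((c `^ p * 2 `^ p * (1 + c' `^ p * K)) `^ p^-1 * 2 `^ p^-1)%:E *
    ('N[mu]_p%:E[g] + W `^ p^-1).
Proof.
move=> mG mg mh G0 g0 h0 W0 p0 c0 c'0 K0 Gle hW.
rewrite (Lnorm_ge0E mu p G0) (Lnorm_ge0E mu p g0).
have mpow (f : T -> \bar R) r : measurable_fun [set: T] f ->
    measurable_fun [set: T] (fun x => f x `^ r).
  exact: (measurableT_comp (measurable_poweR r)).
set X := \int[mu]_x (g x `^ p).
have X0 : 0 <= X by apply: integral_ge0 => x _; exact: poweR_ge0.
have cp0 : (0 <= c `^ p * 2 `^ p)%R by rewrite mulr_ge0 ?powR_ge0.
have D0 : (0 <= 1 + c' `^ p * K)%R by rewrite addr_ge0// mulr_ge0 ?powR_ge0.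
have GX : \int[mu]_x (G x `^ p) <= (c `^ p * 2 `^ p)%:E * (X + (c' `^ p)%:E * (K%:E * W)).
  apply: (@le_trans _ _ (\int[mu]_x ((c `^ p * 2 `^ p)%:E *
      (g x `^ p + (c' `^ p)%:E * h x `^ (p / u))))).
    apply: ge0_le_integral => //.
    - by move=> x _; exact: poweR_ge0.
    - exact: mpow.
    - apply: measurable_funeM; apply: emeasurable_funD; first exact: mpow.
      by apply: measurable_funeM; exact: mpow.
    move=> x _; apply: (le_trans (poweR_le (ltW p0) (G0 x) (Gle x))).
    have ch0 : 0 <= c'%:E * h x `^ u^-1 by rewrite mule_ge0 ?poweR_ge0.
    rewrite poweRM ?adde_ge0// poweR_EFin EFinM -muleA lee_wpmul2l ?lee_fin ?powR_ge0//.
    apply: (le_trans (poweR_add_le (g0 x) ch0 (ltW p0))).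
    rewrite lee_wpmul2l ?lee_fin ?powR_ge0// leeD2l//.
    by rewrite poweRM ?poweR_ge0// poweR_EFin -poweRrM mulrC.
  rewrite ge0_integralZl//; last 2 first.
  - apply: emeasurable_funD; first exact: mpow.
    by apply: measurable_funeM; exact: mpow.
  - by move=> x _; rewrite adde_ge0 ?mule_ge0 ?poweR_ge0// lee_fin powR_ge0.
  rewrite lee_wpmul2l ?lee_fin// ge0_integralD//; last 4 first.
  - by move=> x _; exact: poweR_ge0.
  - exact: mpow.
  - by move=> x _; rewrite mule_ge0 ?poweR_ge0// lee_fin powR_ge0.
  - by apply: measurable_funeM; exact: mpow.
  rewrite leeD2l// ge0_integralZl//; last 3 first.
  - exact: mpow.
  - by move=> x _; exact: poweR_ge0.
  - by rewrite lee_fin powR_ge0.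
  by rewrite lee_wpmul2l ?lee_fin ?powR_ge0.
have GX2 : \int[mu]_x (G x `^ p) <= (c `^ p * 2 `^ p * (1 + c' `^ p * K))%:E * (X + W).
  apply: (le_trans GX); rewrite [in leRHS]EFinM -muleA lee_wpmul2l ?lee_fin//.
  rewrite muleA -EFinM ge0_muleDr//; apply: leeD.
    rewrite -[leLHS]mul1e lee_wpmul2r// lee_fin lerDl mulr_ge0 ?powR_ge0//.
  by rewrite lee_wpmul2r// lee_fin lerDr.
have pV : (0 <= p^-1)%R by rewrite invr_ge0 ltW.
have I0 : 0 <= \int[mu]_x (G x `^ p) by apply: integral_ge0 => x _; exact: poweR_ge0.
apply: (le_trans (poweR_le pV I0 GX2)).
rewrite poweRM; [|by rewrite lee_fin mulr_ge0|exact: adde_ge0].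
rewrite poweR_EFin EFinM -muleA; apply: lee_wpmul2l; first by rewrite lee_fin powR_ge0.
exact: poweR_add_le.
Qed.

End Lp_bounds.

(** * Multiplication by the indicator of an open set *)

Section cutoff.
Context (R : realType) (n : nat) (k : nat) (u s q : R).
Local Open Scope ereal_scope.
Local Notation lambda := (@lebesgue_measure_rV R n).
Local Notation V := (lebesgue_rV R n).
Hypotheses (u0 : (0 < u)%R) (s0 : (0 < s)%R) (uq : (u <= q)%R).
Variables (Omega : set 'rV[R]_n) (f : 'rV[R]_n -> R).
Hypotheses (oO : open Omega) (mf : measurable_fun [set: V] (f : V -> R)).
Hypothesis locf : forall r, \int[lambda]_(y in (cube 0%R r : set V)) (`|f y| `^ u)%:E < +oo.
Local Notation S := (boundary Omega).
Let F := (f \* \1_Omega)%R.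
Let alpha := (s * u)%R.
Let alpha0 : (0 < alpha)%R. Proof. by rewrite mulr_gt0. Qed.
Let b : R := n%:R.
Let dist (x y : V) : R := `|(x : 'rV[R]_n) - y|%R.
Let delta : V -> R := bdist S.

(** The function [H] of the introduction. *)
Definition hardy_quotient (y : 'rV[R]_n) : R :=
  (\1_Omega y * (`|f y| `^ u * bdist S y `^ (- (s * u))))%R.

Lemma hardy_quotient_ge0 y : (0 <= hardy_quotient y)%R.
Proof. by rewrite !mulr_ge0 ?powR_ge0. Qed.

Let H : V -> \bar R := EFin \o (hardy_quotient : V -> R).

Let mOmega : measurable (Omega : set V). Proof. exact: measurable_open. Qed.

Let mcut : measurable_fun [set: V] (\1_Omega : V -> R).
Proof. exact: measurable_indic. Qed.

Lemma measurable_cutoff : measurable_fun [set: V] (F : V -> R).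
Proof. exact: (measurable_funM mf mcut). Qed.

Lemma measurable_hardy_quotient : measurable_fun [set: V] (hardy_quotient : V -> R).
Proof.
apply: (measurable_funM mcut).
apply: measurable_funM.
  exact: (measurableT_comp (measurable_powR _) (measurableT_comp (@normr_measurable R setT) mf)).
exact: (measurableT_comp (measurable_powR _) (measurable_bdist S)).
Qed.

Lemma norm_cutoff_le y : (`|F y| <= `|f y|)%R.
Proof.
rewrite /F/= indicE; case: (_ \in _); first by rewrite mulr1.
by rewrite mulr0 normr0.
Qed.

Lemma loc_cutoff r : \int[lambda]_(y in (cube 0%R r : set V)) (`|F y| `^ u)%:E < +oo.
Proof.
apply: le_lt_trans (locf r).
have mp (g : V -> R) : measurable_fun [set: V] g ->
    measurable_fun (cube 0%R r : set V) (fun y => (`|g y| `^ u)%:E).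
  move=> mg; apply: measurable_funTS; apply/measurable_EFinP.
  exact: (measurableT_comp (measurable_powR _) (measurableT_comp (@normr_measurable R setT) mg)).
apply: ge0_le_integral.
- exact: measurable_cube.
- by move=> y _; rewrite lee_fin powR_ge0.
- exact: (mp _ measurable_cutoff).
- exact: (mp _ mf).
- by move=> y _; rewrite lee_fin powR_le// ?norm_cutoff_le// ltW.
Qed.

Lemma cutoff_powR y : S !=set0 -> (`|F y| `^ u = hardy_quotient y * bdist S y `^ alpha)%R.
Proof.
move=> S0; rewrite /F/= /hardy_quotient indicE; case: (boolP (y \in Omega)) => [|_]; last first.
  by rewrite mulr0 normr0 powR0 ?gt_eqF// !mul0r.
rewrite inE => /(bdist_gt0 oO S0) d0.
by rewrite mulr1 mul1r -mulrA powRN mulVf ?mulr1// gt_eqF ?powR_gt0.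
Qed.

Lemma local_approx_cutoff_sub Q : Q `<=` Omega ->
  local_approx k u F Q = local_approx k u f Q.
Proof.
move=> QO; rewrite /local_approx; apply: (congr1 (@ereal_inf R)); apply: eq_imagel => P _.
apply: (congr1 (fun z => ((lambda Q)^-1 * z) `^ u^-1)).
apply: eq_integral => y; rewrite inE => Qy.
by rewrite /F/= indicE mem_set ?mulr1//; exact: QO.
Qed.

Let local_approx_zero (Q : set 'rV[R]_n) : local_approx k u F Q <=
  ((lambda Q)^-1 * \int[lambda]_(y in (Q : set V)) (`|F y| `^ u)%:E) `^ u^-1.
Proof.
apply: ereal_inf_lbound; exists 0%R; first by rewrite /poly_lt_deg/= mmeasure0.
apply: (congr1 (fun z => ((lambda Q)^-1 * z) `^ u^-1)); apply: eq_integral => y _.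
by rewrite /mpoly_eval meval0 subr0.
Qed.

Lemma local_approx_cutoff_disjoint Q : Q `&` Omega = set0 ->
  local_approx k u F Q = 0.
Proof.
move=> QO; apply/eqP; rewrite eq_le local_approx_ge0 andbT.
apply: (le_trans (local_approx_zero Q)).
rewrite integral0_eq; first by rewrite mule0 poweR0r// invr_neq0// gt_eqF.
move=> y Qy; rewrite /F/= indicE memNset ?mulr0 ?normr0 ?powR0 ?gt_eqF// => Oy.
by have : (Q `&` Omega) y by []; rewrite QO.
Qed.

Let mH : measurable_fun [set: V] H.
Proof. exact/measurable_EFinP/measurable_hardy_quotient. Qed.
Let mdist : measurable_fun [set: V * V] (fun z : V * V => dist z.1 z.2).
Proof. exact: measurable_dist. Qed.
Let mdelta : measurable_fun [set: V] delta. Proof. exact: measurable_bdist. Qed.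

(** The zero polynomial is a competitor in the infimum.  A point [a] of [S] in the cube
gives [bdist S y <= 2 * t] for all [y] in it, whence the constant [3] in [cone_mean]. *)
Lemma local_approx_cutoff_cone x (t : R) : (0 < t)%R -> (cube x t `&` S) !=set0 ->
  (t `^ (- s))%:E * local_approx k u F (cube x t) <=
    cone_mean lebesgue_sf dist delta b alpha H x t `^ u^-1.
Proof.
move=> t0 [a [xa Sa]]; have S0 : S !=set0 by exists a.
have mC := measurable_cube x t.
have mFu : measurable_fun [set: V] (fun y => (`|F y| `^ u)%:E).
  apply/measurable_EFinP.
  exact: (measurableT_comp (measurable_powR _)
    (measurableT_comp (@normr_measurable R setT) measurable_cutoff)).
set I := \int[lambda]_(y in (cube x t : set V)) (`|F y| `^ u)%:E.
have I0 : 0 <= I by apply: integral_ge0 => y _; rewrite lee_fin powR_ge0.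
have uV : (0 <= u^-1)%R by rewrite invr_ge0 ltW.
have tn : (0 < (2 * t) ^+ n)%R by rewrite exprn_gt0// mulr_gt0.
have lE : (lambda (cube x t))^-1 = (((2 * t) ^+ n)^-1)%:E.
  by rewrite [X in X^-1](lebesgue_cube x (ltW t0)) inver gt_eqF.
apply: (@le_trans _ _ ((t `^ (- s))%:E * ((lambda (cube x t))^-1 * I) `^ u^-1)).
  by rewrite lee_wpmul2l ?lee_fin ?powR_ge0// local_approx_zero.
rewrite lE.
have -> : (t `^ (- s))%:E = ((t `^ (- alpha))%:E : \bar R) `^ u^-1.
  by rewrite poweR_EFin -powRrM /alpha -mulNr -mulrA mulfV ?mulr1// gt_eqF.
have tnI : 0 <= (((2 * t) ^+ n)^-1)%:E * I by rewrite mule_ge0// lee_fin invr_ge0 ltW.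
rewrite -poweRM//; last by rewrite lee_fin powR_ge0.
apply: poweR_le => //; first by rewrite mule_ge0// lee_fin powR_ge0.
apply: (@le_trans _ _ ((t `^ (- (b + alpha)))%:E * I)).
  rewrite muleA -EFinM lee_wpmul2r// lee_fin opprD powRD; last by rewrite (gt_eqF t0) implybT.
  rewrite mulrC ler_wpM2r ?powR_ge0// powRN powR_mulrn ?(ltW t0)//.
  rewrite lef_pV2 ?posrE// ?exprn_gt0// lerXn2r ?nnegrE ?(ltW t0)//; first by rewrite mulr_ge0// ltW.
  by rewrite ler_peMl ?ler1n// ltW.
rewrite /I integral_mkcond -ge0_integralZl; last 4 first.
- exact: measurableT.
- by apply/(measurable_restrictT _ mC); exact: measurable_funTS.
- by move=> y _; rewrite patchE; case: ifP => // _; rewrite lee_fin powR_ge0.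
- by rewrite lee_fin powR_ge0.
rewrite /cone_mean lebesgue_sfE; apply: ge0_le_integral.
- exact: measurableT.
- by move=> y _; rewrite patchE; case: ifP => // _; rewrite ?mule0// -EFinM lee_fin mulr_ge0 ?powR_ge0.
- by apply: measurable_funeM; apply/(measurable_restrictT _ mC); exact: measurable_funTS.
- by apply: (measurable_cone_integrand (dist := dist) (delta := delta)); [exact: mdist|exact: mdelta|exact: mH].
move=> y _; rewrite patchE; case: ifPn => [|_]; last first.
  by rewrite mule0 mule_ge0// lee_fin ?hardy_quotient_ge0// !mulr_ge0 ?powR_ge0.
rewrite inE => xy; rewrite cutoff_powR// /H/= -!EFinM lee_fin.
rewrite indicE mem_set ?mulr1; last first.
  rewrite /= /bgauge /delta /dist.
  have h1 := bdist_le y Sa; have h2 := ler_distD x y a.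
  rewrite /cube/= in xy xa; rewrite (distrC y x) in h2; lra.
by rewrite (mulrC (hardy_quotient y)) mulrA.
Qed.

Definition cone_powR_cst := ((3 `^ (b + alpha)) `^ (q / u - 1) * (cone_cst b alpha + 1))%R.

Let b0 : (0 <= b)%R. Proof. exact: ler0n. Qed.
Let q0 : (0 < q)%R. Proof. exact: lt_le_trans uq. Qed.
Let H0 y : 0 <= H y. Proof. by rewrite lee_fin hardy_quotient_ge0. Qed.
Let dist_ge0 x y : (0 <= dist x y)%R. Proof. exact: normr_ge0. Qed.
Let delta_ge0 y : (0 <= delta y)%R. Proof. exact: bdist_ge0. Qed.

Lemma cone_powR_cst_ge0 : (0 <= cone_powR_cst)%R.
Proof. by rewrite mulr_ge0 ?powR_ge0// addr_ge0// cone_cst_ge0. Qed.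

Let I01 : set (measurableTypeR R) := `]0%R, 1%R[%classic.
Let mI01 : measurable I01. Proof. exact: measurable_itv. Qed.

(** The first summand serves the cubes that miss [S], the second those that meet it. *)
Let integrand_cutoff_le x (t : R) : I01 t ->
  ((t `^ (- s))%:E * local_approx k u F (cube x t)) `^ q * (t^-1)%:E <=
  ((t `^ (- s))%:E * local_approx k u f (cube x t)) `^ q * (t^-1)%:E +
  cone_mean lebesgue_sf dist delta b alpha H x t `^ (q / u) * (t^-1)%:E.
Proof.
rewrite /I01/= in_itv/= => /andP[t0 t1].
have tV : 0 <= (t^-1)%:E by rewrite lee_fin invr_ge0 ltW.
have ts : 0 <= (t `^ (- s))%:E by rewrite lee_fin powR_ge0.
have [xS|xS] := pselect (cube x t `&` S !=set0).
  rewrite -[leLHS]add0e; apply: leeD; first by rewrite mule_ge0// poweR_ge0.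
  rewrite lee_wpmul2r// (mulrC q) poweRrM poweR_le ?(ltW q0)//.
    by rewrite mule_ge0// local_approx_ge0.
  exact: local_approx_cutoff_cone.
rewrite -[leLHS]adde0; apply: leeD; last by rewrite mule_ge0// poweR_ge0.
apply: (lee_wpmul2r tV); apply: (poweR_le (ltW q0)).
  by rewrite mule_ge0// local_approx_ge0.
apply: (lee_wpmul2l ts).
have {}xS : cube x t `&` S = set0 by apply/eqP/negP => /negP/set0P.
have [QO|QO] := cube_sub_or_disjoint oO xS.
  by rewrite local_approx_cutoff_sub.
by rewrite local_approx_cutoff_disjoint// local_approx_ge0.
Qed.

Lemma TL_fun_cutoff_le x : TL_fun k u s q F x <= (2 `^ q^-1)%:E *
  (TL_fun k u s q f x + (cone_powR_cst `^ q^-1)%:E *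
     potential lebesgue_sf dist delta b alpha H x `^ u^-1).
Proof.
have r1 : (1 <= q / u)%R by rewrite ler_pdivlMr// mul1r.
have qV : (0 <= q^-1)%R by rewrite invr_ge0 ltW.
have i0 (E : \bar R) (t : R) : I01 t -> 0 <= E -> 0 <= E * (t^-1)%:E.
  by rewrite /I01/= in_itv/= => /andP[t0 _] E0; rewrite mule_ge0// lee_fin invr_ge0 ltW.
have mt : measurable_fun I01 (fun t : measurableTypeR R => (t^-1)%:E).
  apply/measurable_EFinP.
  apply: (eq_measurable_fun ((@powR R) ^~ (-1)%R)); last first.
    by apply: measurable_funTS; exact: measurable_powR.
  by move=> t; rewrite inE/I01/= in_itv/= => /andP[t0 _]; rewrite powR_inv1 ?ltW.
have mcone : measurable_fun I01 (fun t : measurableTypeR R =>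
    cone_mean lebesgue_sf dist delta b alpha H x t `^ (q / u) * (t^-1)%:E).
  apply: emeasurable_funM => //; apply: (measurableT_comp (measurable_poweR _)).
  by apply: measurable_funTS; exact: measurable_cone_mean.
pose gF (t : measurableTypeR R) :=
  ((t `^ (- s))%:E * local_approx k u F (cube x t)) `^ q * (t^-1)%:E.
pose gf (t : measurableTypeR R) :=
  ((t `^ (- s))%:E * local_approx k u f (cube x t)) `^ q * (t^-1)%:E.
pose gc (t : measurableTypeR R) :=
  cone_mean lebesgue_sf dist delta b alpha H x t `^ (q / u) * (t^-1)%:E.
have mgF : measurable_fun I01 gF.
  exact: (measurable_TL_integrand u0 measurable_cutoff loc_cutoff k s q x).
have mgf : measurable_fun I01 gf by exact: (measurable_TL_integrand u0 mf locf k s q x).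
have gF0 t : I01 t -> 0 <= gF t by move=> tI; apply: i0 => //; exact: poweR_ge0.
have gf0 t : I01 t -> 0 <= gf t by move=> tI; apply: i0 => //; exact: poweR_ge0.
have gc0 t : I01 t -> 0 <= gc t by move=> tI; apply: i0 => //; exact: poweR_ge0.
have potge0 : 0 <= potential lebesgue_sf dist delta b alpha H x by exact: potential_ge0.
have IF : \int[lebesgue_measure]_(t in I01) gF t <=
    \int[lebesgue_measure]_(t in I01) gf t +
    cone_powR_cst%:E * potential lebesgue_sf dist delta b alpha H x `^ (q / u).
  apply: (@le_trans _ _ (\int[lebesgue_measure]_(t in I01) (gf t + gc t))).
    apply: ge0_le_integral.
    - exact: mI01.
    - exact: gF0.
    - exact: mgF.
    - exact: (emeasurable_funD mgf mcone).
    - by move=> t tI; exact: integrand_cutoff_le.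
  rewrite (ge0_integralD lebesgue_measure mI01 gf0 mgf gc0 mcone); apply: leeD; first exact: lexx.
  exact: (integral_cone_mean_powR lebesgue_sf mdist mdelta dist_ge0 delta_ge0 b0 alpha0 x mH H0 r1).
have IF0 : 0 <= \int[lebesgue_measure]_(t in I01) gF t by apply: integral_ge0; exact: gF0.
have If0 : 0 <= \int[lebesgue_measure]_(t in I01) gf t by apply: integral_ge0; exact: gf0.
have cp0 : 0 <= cone_powR_cst%:E * potential lebesgue_sf dist delta b alpha H x `^ (q / u).
  by rewrite mule_ge0 ?poweR_ge0// lee_fin cone_powR_cst_ge0.
apply: (le_trans (poweR_le qV IF0 IF)).
apply: (le_trans (poweR_add_le If0 cp0 qV)).
apply: lee_wpmul2l; first by rewrite lee_fin powR_ge0.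
apply: leeD; first exact: lexx.
rewrite poweRM ?poweR_ge0//; last by rewrite lee_fin cone_powR_cst_ge0.
rewrite poweR_EFin -poweRrM (_ : q / u * q^-1 = u^-1)%R//.
by rewrite mulrAC mulfV ?mul1r// gt_eqF.
Qed.

End cutoff.

(** * The Hardy term and the conclusion *)

Section hardy.
Context (R : realType) (n : nat) (u s p : R).
Local Open Scope ereal_scope.
Local Notation lambda := (@lebesgue_measure_rV R n).
Local Notation V := (lebesgue_rV R n).
Hypotheses (u0 : (0 < u)%R) (s0 : (0 < s)%R) (p0 : (0 < p)%R).
Variables (Omega : set 'rV[R]_n) (f : 'rV[R]_n -> R).
Hypothesis oO : open Omega.
Local Notation S := (boundary Omega).

(** If the boundary is empty, both sides vanish: the left one because [bdist] is 0 and the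
exponent is nonzero, the right one because [edist_inf] is infinite. *)
Lemma hardy_quotient_powR y : Omega y ->
  (hardy_quotient u s Omega f y `^ (p / u))%:E =
  (`|f y| `^ p)%:E / edist_inf S y `^ (s * p).
Proof.
move=> Oy; have un0 : u != 0%R by rewrite gt_eqF.
rewrite /hardy_quotient indicE mem_set// mul1r.
have [S0|/set0P/negP/negPn/eqP S0] := pselect (S !=set0); last first.
  have -> : edist_inf S y = +oo by rewrite /edist_inf S0 image_set0 ereal_inf0.
  rewrite /bdist S0 /edist_inf image_set0 ereal_inf0/=.
  have su : (s * u)%R != 0%R by rewrite mulf_neq0// gt_eqF.
  have -> : (0 `^ (- (s * u)) = 0 :> R)%R by rewrite powR0// oppr_eq0.
  have -> : (s * p == 0)%R = false by apply/negbTE; rewrite mulf_neq0// gt_eqF.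
  rewrite mulr0 powR0 ?invey ?mule0//.
  by rewrite mulf_neq0// ?invr_neq0// gt_eqF.
have d0 := bdist_gt0 oO S0 Oy.
rewrite bdistE// poweR_EFin inver gt_eqF ?powR_gt0// -EFinM; congr (_%:E).
rewrite powRM ?powR_ge0// -!powRrM.
have -> : (u * (p / u) = p)%R by rewrite mulrCA mulfV// mulr1.
have -> : (- (s * u) * (p / u) = - (s * p))%R by field.
by rewrite powRN.
Qed.

Lemma integral_hardy_quotient :
  \int[lambda]_y (hardy_quotient u s Omega f y `^ (p / u))%:E =
  \int[lambda]_(y in (Omega : set V)) ((`|f y| `^ p)%:E / edist_inf S y `^ (s * p)).
Proof.
rewrite [RHS]integral_mkcond; apply: eq_integral => y _.
rewrite patchE; case: ifPn => [|yO]; first by rewrite inE => /hardy_quotient_powR.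
by rewrite /hardy_quotient indicE (negbTE yO) mul0r powR0// mulf_neq0 ?invr_neq0 ?gt_eqF.
Qed.

End hardy.

Lemma TL_normE (R : realType) n k (u s p q : R) (f : 'rV[R]_n -> R) : in_TL k u s p q f ->
  (TL_norm k u s p q f = 'N[lebesgue_measure_rV]_p%:E[EFin \o f] +
     'N[lebesgue_measure_rV]_p%:E[TL_fun k u s q f])%E.
Proof. by move=> fTL; rewrite /TL_norm asboolT. Qed.

Theorem proposition4p1 (R : realType) (n : nat) (hn : (2 <= n)%N)
    (p q s : R) (hp : 1 < p) (hq : 1 <= q) (hs : 0 < s)
    (k : nat) (hk : s < k%:R) (u : R) (hu : 1 <= u <= Num.min p q)
    (S : set 'rV[R]_n)
    (hS : porous S \/ exists2 d : R, d < n%:R & d_set d S) :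
  exists2 c : R, 0 < c &
    forall (Omega : set 'rV[R]_n), domain Omega -> boundary Omega = S ->
    forall f : 'rV[R]_n -> R, in_TL k u s p q f ->
      (TL_norm k u s p q (f \* \1_Omega)%R <=
       c%:E * (TL_norm k u s p q f + hardy_term s p f Omega))%E.
Proof.
have [u1 up uq] : [/\ 1 <= u, u <= p & u <= q].
  by move: hu; rewrite le_min => /andP[-> /andP[-> ->]].
have u0 : 0 < u by rewrite (lt_le_trans ltr01).
have p0 : 0 < p by rewrite (lt_trans ltr01).
have pu1 : 1 <= p / u by rewrite ler_pdivlMr// mul1r.
have pV : 0 <= p^-1 by rewrite invr_ge0 ltW.
have su0 : 0 < s * u by rewrite mulr_gt0.
pose dist (x y : lebesgue_rV R n) : R := `|(x : 'rV[R]_n) - y|.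
have mdist : measurable_fun [set: lebesgue_rV R n * lebesgue_rV R n]
  (fun z : lebesgue_rV R n * lebesgue_rV R n => dist z.1 z.2) by exact: measurable_dist.
have dist_ge0 x y : 0 <= dist x y by exact: normr_ge0.
have distC x y : dist x y = dist y x by exact: distrC.
have dist_tri x y z : dist x z <= dist x y + dist y z by exact: ler_distD.
have lam_ball (y : lebesgue_rV R n) (r : R) : 0 < r ->
    (lebesgue_sf [set x | (dist x y <= r)%R] <= (2 ^+ n * r `^ n%:R)%:E)%E.
  move=> r0; rewrite (_ : [set x | _] = cube y r).
    rewrite [leLHS](lebesgue_cube y (ltW r0)) lee_fin powR_mulrn ?(ltW r0)//.
    by rewrite exprMn.
  by apply/seteqP; split=> x; rewrite /cube/= /dist distrC.
pose K := potential_Lp_cst (2 ^+ n) n%:R (s * u) (p / u).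
pose c1 := 2 `^ q^-1 : R.
pose c2 := cone_powR_cst n u s q `^ q^-1.
pose D := (c1 `^ p * 2 `^ p * (1 + c2 `^ p * K)) `^ p^-1 * 2 `^ p^-1.
have D0 : 0 <= D by rewrite mulr_ge0 ?powR_ge0.
have K0 : 0 <= K by exact: (potential_Lp_cst_ge0 su0 lam_ball).
exists (1 + D); first by rewrite ltr_wpDr.
move=> Omega [oO _ _] _ f fTL.
have [[mEf Nf] [mTf NTf]] := fTL.
have mf : measurable_fun [set: lebesgue_rV R n] (f : lebesgue_rV R n -> R).
  exact/measurable_EFinP.
have TL0 (g : 'rV[R]_n -> R) x : (0 <= TL_fun k u s q g x)%E by exact: poweR_ge0.
have Tnorm0 (g : 'rV[R]_n -> R) : (0 <= TL_norm k u s p q g)%E.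
  by rewrite /TL_norm; case: ifP => // _; rewrite adde_ge0// Lnorm_ge0.
have hardy0 : (0 <= hardy_term s p f Omega)%E by exact: poweR_ge0.
have [hoo|hoo] := eqVneq (hardy_term s p f Omega) +oo%E.
  rewrite hoo addey; last by rewrite -ltNye (lt_le_trans _ (Tnorm0 f)).
  by rewrite gt0_muley ?leey// lte_fin ltr_wpDr.
have locf r : (\int[lebesgue_measure_rV]_(y in (cube 0%R r : set (lebesgue_rV R n)))
    (`|f y| `^ u)%:E < +oo)%E.
  apply: (integral_powR_lty (p := p)).
  - exact: measurable_cube.
  - exact: mf.
  - by rewrite u0.
  - have [r0|r0] := leP 0 r.
      by rewrite [X in (X < _)%E](lebesgue_cube 0 r0) ltry.
    rewrite (_ : cube 0 r = set0) ?measure0//.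
    by apply/seteqP; split=> y //=; rewrite /cube/= leNgt (lt_le_trans r0).
  apply: (@lty_poweRy R _ p^-1); first by rewrite invr_neq0// gt_eqF.
  by move: Nf; rewrite Lnorm_EFinE.
pose F := (f \* \1_Omega)%R.
have mF : measurable_fun [set: lebesgue_rV R n] (F : lebesgue_rV R n -> R).
  exact: measurable_cutoff.
have mTF : measurable_fun [set: lebesgue_rV R n]
    (TL_fun k u s q F : lebesgue_rV R n -> \bar R).
  exact: (measurable_TL_fun u0 mF (loc_cutoff u0 oO mf locf) k s q).
have NF : ('N[lebesgue_measure_rV]_p%:E[EFin \o F] <=
           'N[lebesgue_measure_rV]_p%:E[EFin \o f])%E.
  rewrite !Lnorm_EFinE; apply: poweR_le => //.
    by apply: integral_ge0 => x _; rewrite lee_fin powR_ge0.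
  have mp (g : lebesgue_rV R n -> R) : measurable_fun [set: lebesgue_rV R n] g ->
      measurable_fun [set: lebesgue_rV R n] (fun y => (`|g y| `^ p)%:E).
    move=> mg; apply/measurable_EFinP.
    exact: (measurableT_comp (measurable_powR _) (measurableT_comp (@normr_measurable R setT) mg)).
  apply: ge0_le_integral.
  - exact: measurableT.
  - by move=> y _; rewrite lee_fin powR_ge0.
  - exact: (mp _ mF).
  - exact: (mp _ mf).
  - by move=> y _; rewrite lee_fin powR_le ?(ltW p0)// norm_cutoff_le.
have mH := measurable_hardy_quotient u s oO mf.
have NTF : ('N[lebesgue_measure_rV]_p%:E[TL_fun k u s q F] <= D%:E *
    ('N[lebesgue_measure_rV]_p%:E[TL_fun k u s q f] + hardy_term s p f Omega))%E.
  have mpot := measurable_potential lebesgue_sf n%:R (s * u) mdist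
    (measurable_bdist (boundary Omega)) (proj2 (measurable_EFinP _ _) mH)
    (fun y => hardy_quotient_ge0 u s Omega f y).
  have W0 : (0 <= \int[lebesgue_measure_rV]_(y in (Omega : set (lebesgue_rV R n)))
      ((`|f y| `^ p)%:E / edist_inf (boundary Omega) y `^ (s * p)))%E.
    rewrite -(integral_hardy_quotient u0 hs p0 f oO).
    by apply: integral_ge0 => y _; rewrite lee_fin powR_ge0.
  apply: (Lp_bound_of_pointwise mTF mTf mpot (TL0 F) (TL0 f) _ W0 p0 _ _ K0).
  - by move=> x; apply: potential_ge0 => y; rewrite lee_fin hardy_quotient_ge0.
  - exact: powR_ge0.
  - exact: powR_ge0.
  - by move=> x; exact: TL_fun_cutoff_le.
  rewrite -(integral_hardy_quotient u0 hs p0 f oO).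
  exact: (potential_Lp_bounded mdist (measurable_bdist (boundary Omega)) dist_ge0 distC dist_tri
      (bdist_ge0 (boundary Omega)) (ler0n _ _) su0 lam_ball pu1 mH (hardy_quotient_ge0 u s Omega f)).
have hfin : (hardy_term s p f Omega < +oo)%E by rewrite ltey.
have NTFoo : ('N[lebesgue_measure_rV]_p%:E[TL_fun k u s q F] < +oo)%E.
  apply: (le_lt_trans NTF); rewrite lte_mul_pinfty ?lee_fin//.
  exact: lte_add_pinfty.
have FTL : in_TL k u s p q F.
  split; split.
  - exact/measurable_EFinP.
  - exact: le_lt_trans Nf.
  - exact: mTF.
  - exact: NTFoo.
rewrite [leLHS](TL_normE FTL) [X in (_ * (X + _))%E](TL_normE fTL).
have Nf0 : (0 <= 'N[lebesgue_measure_rV]_p%:E[EFin \o f])%E by exact: Lnorm_ge0.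
have NTf0 : (0 <= 'N[lebesgue_measure_rV]_p%:E[TL_fun k u s q f])%E by exact: Lnorm_ge0.
rewrite EFinD ge0_muleDl ?lee_fin// mul1e; apply: leeD.
  by apply: (le_trans NF); rewrite -addeA leeDl// adde_ge0.
apply: (le_trans NTF); apply: lee_wpmul2l; first by rewrite lee_fin.
by rewrite -addeA leeDr.
Qed.
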